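(* Let $(X,\rho,\mu)$ be a quasimetric measure space whose measure satisfies the growth condition: there is $C_0>0$ with $\mu(B(a,r))\le C_0 r$ for all $a\in X$, $r>0$. Suppose $1<p\le q<\infty$, $1/p-1/q\le\alpha<1$, $\alpha\ne 1/p$, $p\alpha-1<\beta<p-1$, $0<\lambda_1<\beta-\alpha p+1$ and $\lambda_1 q=\lambda_2 p$. Then $I_\alpha$ is bounded from $M^{p,\lambda_1}_\beta(X,\mu)$ to $M^{q,\lambda_2}_\gamma(X,\mu)$, where $\gamma=q(1/p+\beta/p-\alpha)-1$.
   Context: A quasimetric measure space $(X,\rho,\mu)$ (doubling of $\mu$ is not assumed): $X$ is a topological space with a complete measure $\mu$ such that compactly supported continuous functions are dense in $L^1(X,\mu)$, and $\rho:X\times X\to[0,\infty)$ satisfies: $\rho(x,y)>0$ for $x\ne y$ and $\rho(x,x)=0$; $\rho(x,y)\le a_0\rho(y,x)$ for some constant $a_0\ge1$; $\rho(x,y)\le a_1(\rho(x,z)+\rho(z,y))$ for some constant $a_1\ge1$. Balls $B(a,r)=\{x\in X:\rho(x,a)<r\}$ are measurable with $0\le\mu(B(a,r))<\infty$; every neighborhood of $x$ contains some ball $B(x,r)$; $\mu(X)=\infty$, $\mu\{a\}=0$ for all $a$, and $B(a,r_2)\setminus B(a,r_1)\neq\emptyset$ for all $a\in X$, $0<r_1<r_2<\infty$. For $0<\alpha<1$, $I_\alpha f(x)=\int_X f(y)\rho(x,y)^{\alpha-1}\,d\mu(y)$. For $\beta\in\mathbb R$, $\lambda\ge0$, $1\le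 p<\infty$, the weighted Morrey space $M^{p,\lambda}_\beta(X,\mu)$ is the set of $\mu$-measurable $f$ with $\|f\|_{M^{p,\lambda}_\beta(X,\mu)}=\sup_{a\in X,r>0}\big(r^{-\lambda}\int_{B(a,r)}|f(y)|^p\rho(a,y)^\beta\,d\mu(y)\big)^{1/p}<\infty$.
   Formalization: The hypotheses do not make ρ(x,·) or I_α f measurable, so boundedness is proved as the norm inequality alone, with integrals of nonmeasurable functions read as lower integrals; measurability of I_α f, part of membership in the target space, is not asserted. *)

(* Defs.v *)
From HB Require Import structures.
From mathcomp Require Import all_boot all_order all_algebra.
From mathcomp Require Import all_classical all_reals all_analysis.
Set Implicit Arguments. Unset Strict Implicit. Unset Printing Implicit Defensive.
Import Order.TTheory GRing.Theory Num.Theory.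
Import numFieldNormedType.Exports.
Local Open Scope classical_set_scope.
Local Open Scope ring_scope.

Section QMS.
Context {R : realType} {d : measure_display} {X : measurableType d}.

Definition qball (rho : X -> X -> R) (a : X) (r : R) : set X :=
  [set x | rho x a < r].

Definition is_topology (op : set (set X)) : Prop :=
  [/\ op setT, op set0,
      (forall F : set (set X), F `<=` op -> op (\bigcup_(A in F) A)) &
      (forall A B, op A -> op B -> op (A `&` B))].

Definition op_continuous (op : set (set X)) (g : X -> R) : Prop :=
  forall U : set R, open U -> op (g @^-1` U).

Definition op_closure (op : set (set X)) (A : set X) : set X :=
  [set x | forall U, op U -> U x -> U `&` A !=set0].

Definition op_compact (op : set (set X)) (K : set X) : Prop :=
  forall F : set (set X), F `<=` op -> K `<=` \bigcup_(A in F) A ->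
    exists G : set (set X), [/\ G `<=` F, finite_set G &
                                K `<=` \bigcup_(A in G) A].

Definition op_compact_support (op : set (set X)) (g : X -> R) : Prop :=
  op_compact op (op_closure op [set x | g x != 0]).

Definition quasimetric_measure_space (op : set (set X))
  (rho : X -> X -> R) (mu : {measure set X -> \bar R}) : Prop :=
  [/\ is_topology op,
      measure_is_complete mu,
      (forall f : X -> R, mu.-integrable setT (EFin \o f) ->
        forall eps : R, 0 < eps -> exists g : X -> R,
          [/\ op_continuous op g, op_compact_support op g,
              mu.-integrable setT (EFin \o g) &
              (\int[mu]_x (`|f x - g x|%:E) < eps%:E)%E]),
      [/\ (forall x y, 0 <= rho x y),
          (forall x y, x != y -> 0 < rho x y),
          (forall x, rho x x = 0) &
          exists a0 a1 : R, [/\ 1 <= a0, 1 <= a1,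
            (forall x y, rho x y <= a0 * rho y x) &
            (forall x y z, rho x y <= a1 * (rho x z + rho z y))]] &
      [/\ (forall a r, measurable (qball rho a r)),
          (forall a r, (mu (qball rho a r) < +oo)%E),
          (forall x U, op U -> U x -> exists2 r : R, 0 < r & qball rho x r `<=` U) &
          [/\ (mu setT = +oo)%E, (forall a, mu [set a] = 0%E) &
          (forall a r1 r2, 0 < r1 -> r1 < r2 ->
             qball rho a r2 `\` qball rho a r1 !=set0)]]].

Definition frac_int (rho : X -> X -> R) (mu : {measure set X -> \bar R})
  (alpha : R) (f : X -> R) (x : X) : \bar R :=
  (\int[mu]_y (f y * rho x y `^ (alpha - 1))%:E)%E.

Definition morrey_norm (rho : X -> X -> R) (mu : {measure set X -> \bar R})
  (p lambda beta : R) (g : X -> \bar R) : \bar R :=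
  ereal_sup [set v | exists (a : X) (r : R), 0 < r /\ v =
     (((r `^ (- lambda))%:E *
       \int[mu]_(y in qball rho a r)
          ((`|g y| `^ p) * (rho a y `^ beta)%:E)) `^ (p^-1))%E].
End QMS.

(* Main.v *)
(* For x at distance about r from the centre a, split the fractional integral of
   f at x over the points y much nearer to a than x, comparable to x, and much farther
   from a.  Writing kappa = (lambda1 - beta - 1) / p, a function of Morrey norm N has
   mean at most a constant times N S^kappa on the shell of radius S around a, so the
   first and third parts are sums over dyadic shells, geometric because kappa + 1 > 0
   and kappa + alpha < 0, and both are at most a constant times N r^(kappa + alpha).
   The middle part is treated by Hedberg's trick: it is bounded pointwise by the power
   p / q of a maximal function with dyadic radii, for which the growth condition
   and a Vitali selection give a weak (1,1) bound without doubling.  Summing the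
   resulting L^q bounds over the shells r / 2^(n+1) <= rho(x, a) < r / 2^n gives
   the power r^lambda2.

   Since only rho(_, x), and not rho(x, _), is assumed measurable, the integrals in
   the statement may be integrals of nonmeasurable functions, which the library
   defines as lower integrals; and no joint measurability of rho is available, so that
   Fubini's theorem is avoided altogether: the maximal function is replaced by a
   measurable majorant built from the sets given by the covering argument. *)
Require Import Defs.
From HB Require Import structures.
From mathcomp Require Import all_boot all_order all_algebra.
From mathcomp Require Import all_classical all_reals all_analysis.
From mathcomp Require Import measurable_realfun ring lra finmap.
Import Order.TTheory GRing.Theory Num.Theory.
Import numFieldNormedType.Exports.
Local Open Scope classical_set_scope.
Local Open Scope ring_scope.
Set Implicit Arguments.
Unset Strict Implicit.
Unset Printing Implicit Defensive.

(** * Lower integrals *)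

Section lower_integral.
Context {d : measure_display} {T : measurableType d} {R : realType}.
Variable mu : {measure set T -> \bar R}.
Local Open Scope ereal_scope.
Import HBNNSimple.

(** The integral of a nonnegative function is a supremum over the simple functions below it, so
    monotonicity needs no measurability. *)
Lemma ge0_le_lower_integral (D : set T) (f g : T -> \bar R) :
  (forall x, D x -> 0 <= f x) -> (forall x, D x -> f x <= g x) ->
  \int[mu]_(x in D) f x <= \int[mu]_(x in D) g x.
Proof.
move=> f0 fg; have g0 x : D x -> 0 <= g x.
  by move=> Dx; exact: le_trans (f0 _ Dx) (fg _ Dx).
rewrite !ge0_integralE//; apply: le_ereal_sup => _ /= [h hf <-].
exists h => // x; apply: le_trans (hf x) _.
by rewrite /patch; case: ifP => // /set_mem /fg.
Qed.

Lemma ge0_lower_subset_integral (D E : set T) (f : T -> \bar R) :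
  (forall x, E x -> 0 <= f x) -> D `<=` E ->
  \int[mu]_(x in D) f x <= \int[mu]_(x in E) f x.
Proof.
move=> f0 DE; rewrite integral_mkcond [leRHS]integral_mkcond.
apply: ge0_le_lower_integral => x _; rewrite /patch; case: ifP => //.
  by move=> /set_mem/DE; exact: f0.
- by move=> /set_mem/DE Ex; rewrite mem_set.
- by move=> _; case: ifP => // /set_mem/f0.
Qed.

(* A simple function below [h] on [D] splits along a measurable cover of [D],
   so measurability of [h] is irrelevant. *)
Lemma lower_integral_bigcup (D : set T) (F : (set T)^nat) (h : T -> \bar R) :
  (forall x, 0 <= h x) -> (forall n, measurable (F n)) ->
  D `<=` \bigcup_n F n ->
  \int[mu]_(x in D) h x <= \sum_(n <oo) \int[mu]_(x in F n) h x.
Proof.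
move=> h0 mF DF; rewrite {1}ge0_integralE//; apply: ge_ereal_sup => _ /= [s sh <-].
have sD x : (s x)%:E <= (h \_ D) x by exact: sh.
pose s' : T -> \bar R := fun x => (s x)%:E.
have ms : measurable_fun setT s'.
  by apply/measurable_EFinP; exact: measurable_funPT.
have s0 x : 0 <= s' x by rewrite lee_fin; exact: fun_ge0.
rewrite -integralT_nnsfun.
apply: (@le_trans _ _ (\int[mu]_x \sum_(n <oo) (s' \_ (F n)) x)).
  apply: ge0_le_lower_integral => [x _|x _]; first exact: s0.
  have sF n : 0 <= (s' \_ (F n)) x by rewrite /patch; case: ifP.
  have [Dx|nDx] := pselect (D x); last first.
    apply: le_trans (sD x) _; rewrite /patch memNset//.
    by apply: nneseries_ge0 => n _ _; exact: sF.
  have [n _ Fx] := DF _ Dx.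
  apply: (le_trans _ (nneseries_lim_ge n.+1 _)); last by [].
  rewrite big_nat_recr//= {2}/patch mem_set//=.
  by rewrite leeDr// sume_ge0.
rewrite integral_nneseries//; first last.
- by move=> n x _; rewrite /patch; case: ifP.
- move=> n; have [+ _] := measurable_restrictT s' (mF n).
  by apply; exact: measurable_funTS.
apply: lee_nneseries => [n _ _|n _]; first by apply: integral_ge0 => x _; rewrite /patch; case: ifP.
rewrite -integral_mkcond; apply: ge0_le_lower_integral => x Fx; first exact: s0.
apply: le_trans (sD x) _; rewrite /patch; case: ifP => //.
Qed.

Lemma lower_integral_null (F : set T) (h : T -> \bar R) :
  (forall x, 0 <= h x) -> measurable F -> mu F = 0 ->
  \int[mu]_(x in F) h x = 0.
Proof.
move=> h0 mF F0; apply/eqP; rewrite eq_le integral_ge0// andbT.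
apply: (@le_trans _ _ (\int[mu]_(x in F) cst +oo x)).
  by apply: ge0_le_lower_integral => // x _; rewrite leey.
by rewrite integral_cst// F0 mule0.
Qed.

Lemma lower_integral_setU (A B : set T) (h : T -> \bar R) :
  (forall x, 0 <= h x) -> measurable A -> measurable B ->
  \int[mu]_(x in A `|` B) h x <= \int[mu]_(x in A) h x + \int[mu]_(x in B) h x.
Proof.
move=> h0 mA mB.
have mAB n : measurable (bigcup2 A B n) by case: n => [|[|n]]//=.
have := @lower_integral_bigcup (A `|` B) (bigcup2 A B) h h0 mAB.
rewrite bigcup2E => /(_ (@subset_refl _ _)) /le_trans; apply.
rewrite (nneseries_split 0 2)//=; last by move=> k _; apply: integral_ge0.
rewrite eseries0 ?adde0; last first.
  by move=> [|[|n]]//= _ _; rewrite integral_set0.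
by rewrite !big_nat_recl// big_geq//= adde0.
Qed.

(** Without measurability the integrals of the positive and negative parts need not add up to that
    of [|f|]; each is still at most it, and two numbers in [[0, c]] differ by at most [c]. *)
Lemma le_abse_lower_integral (D : set T) (f : T -> \bar R) :
  `|\int[mu]_(x in D) f x| <= \int[mu]_(x in D) `|f x|.
Proof.
rewrite integralE.
have P0 : 0 <= \int[mu]_(x in D) f^\+ x by apply: integral_ge0.
have N0 : 0 <= \int[mu]_(x in D) f^\- x by apply: integral_ge0.
have Pf : \int[mu]_(x in D) f^\+ x <= \int[mu]_(x in D) `|f x|.
  apply: ge0_le_lower_integral => // x _.
  by rewrite -[leRHS]/((abse \o f) x) fune_abse leeDl.
have Nf : \int[mu]_(x in D) f^\- x <= \int[mu]_(x in D) `|f x|.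
  apply: ge0_le_lower_integral => // x _.
  by rewrite -[leRHS]/((abse \o f) x) fune_abse leeDr.
move: P0 N0 Pf Nf.
case: (\int[mu]_(x in D) f^\+ x) => [a||]//; case: (\int[mu]_(x in D) f^\- x) => [b||]//.
rewrite !lee_fin => a0 b0.
case: (\int[mu]_(x in D) `|f x|) => [c||]//; last by rewrite !leey.
rewrite -EFinB abse_EFin !lee_fin => ac bc.
by rewrite ler_norml; apply/andP; split; lra.
Qed.

Lemma nneseries_le_ub (u : (\bar R)^nat) (M : \bar R) :
  (forall n, 0 <= u n) -> (forall n, \sum_(0 <= i < n) u i <= M) ->
  \sum_(n <oo) u n <= M.
Proof.
move=> u0 uM; apply: lime_le; first exact: is_cvg_nneseries.
by apply: nearW => n; exact: uM.
Qed.

End lower_integral.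

(** * Dyadic sums of powers *)

Section dyadic_sums.
Context {R : realType}.
Implicit Types (c u v : R) (n k : nat).

Lemma exp2n_ge1 k : 1 <= 2 ^+ k :> R.
Proof. by rewrite exprn_ege1// ler1n. Qed.

Lemma exp2n_gt0 k : 0 < 2 ^+ k :> R.
Proof. exact: exprn_gt0. Qed.

Lemma powR_exp2n c k : (2 ^+ k) `^ c = (2 `^ c) ^+ k :> R.
Proof. by rewrite -!powR_mulrn ?powR_ge0// -!powRrM mulrC. Qed.

Lemma ler_powR_base c x y : 0 <= c -> 0 <= x -> x <= y -> x `^ c <= y `^ c :> R.
Proof.
by move=> c0 x0 xy; apply: ge0_ler_powR => //; rewrite nnegrE// (le_trans x0).
Qed.

Lemma ger_powR_base c x y : c <= 0 -> 0 < x -> x <= y -> y `^ c <= x `^ c :> R.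
Proof.
move=> c0 x0 xy; rewrite -(opprK c) !(powRN _ (- c)).
rewrite lef_pV2 ?posrE ?powR_gt0//; last exact: lt_le_trans xy.
by apply: ler_powR_base; rewrite ?oppr_ge0// ltW.
Qed.

Lemma powR2_gt1 c : 0 < c -> 1 < 2 `^ c :> R.
Proof. by move=> c0; rewrite /powR pnatr_eq0/= expR_gt1 mulr_gt0 ?ln_gt0 ?ltr1n. Qed.

Lemma powR2N_lt1 c : 0 < c -> 2 `^ (- c) < 1 :> R.
Proof. by move=> c0; rewrite powRN invf_lt1 ?powR2_gt1// powR_gt0. Qed.

(** A geometric sum with ratio [2 ^ c > 1] is controlled by its last term, and the terms stop at
    [2 ^ k < u]. *)
Lemma sum_dyadic_below c u n : 0 < c -> 0 <= u ->
  \sum_(0 <= k < n) (2 ^+ k < u)%R%:R * (2 ^+ k) `^ c <=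
  2 `^ c / (2 `^ c - 1) * u `^ c.
Proof.
move=> c0 u0; have X1 := powR2_gt1 c0; set X := 2 `^ c in X1 *.
have X10 : 0 < X - 1 by rewrite subr_gt0.
have X0 : 0 <= X by rewrite powR_ge0.
have full m : \sum_(0 <= k < m) (2 ^+ k < u)%R%:R * (2 ^+ k) `^ c <= X ^+ m / (X - 1).
  elim: m => [|m IH]; first by rewrite big_geq// mulr_ge0// invr_ge0 ltW.
  rewrite big_nat_recr//= exprS; apply: (@le_trans _ _ (X ^+ m / (X - 1) + X ^+ m)).
    rewrite lerD// powR_exp2n -/X; case: ltP => _; rewrite ?mul1r ?mul0r//.
    by rewrite exprn_ge0.
  by rewrite le_eqVlt; apply/orP; left; apply/eqP; field; rewrite gt_eqF.
elim: n => [|n IH]; first by rewrite big_geq// !mulr_ge0 ?invr_ge0 ?powR_ge0// ltW.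
have [un|un] := ltP (2 ^+ n) u; last first.
  by rewrite big_nat_recr//= ltNge un/= mul0r addr0.
apply: le_trans (full n.+1) _; rewrite exprS mulrAC ler_wpM2l//.
  by rewrite mulr_ge0// invr_ge0 ltW.
by rewrite -powR_exp2n; apply: ler_powR_base; rewrite ?ltW// exp2n_gt0.
Qed.

(** Here the ratio [2 ^ (- c)] is below 1, and the first term past the crossing [u <= 2 ^ k]
    dominates. *)
Lemma sum_dyadic_above c u n : 0 < c -> 0 < u ->
  \sum_(0 <= k < n) (u <= 2 ^+ k)%R%:R * (2 ^+ k) `^ (- c) <=
  (1 - 2 `^ (- c))^-1 * u `^ (- c).
Proof.
move=> c0 u0; have x1 := powR2N_lt1 c0; set x := 2 `^ (- c) in x1 *.
have x10 : 0 < 1 - x by rewrite subr_gt0.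
have x0 : 0 <= x by rewrite powR_ge0.
(* The subtracted minimum is the room left for the terms to come: it is constant while [2 ^ n <= u],
   then shrinks geometrically. *)
suff : \sum_(0 <= k < n) (u <= 2 ^+ k)%R%:R * (2 ^+ k) `^ (- c) <=
       (1 - x)^-1 * (u `^ (- c) - Num.min (u `^ (- c)) (x ^+ n)).
  move=> /le_trans; apply; rewrite ler_wpM2l ?invr_ge0 ?(ltW x10)//.
  by rewrite gerBl le_min powR_ge0 exprn_ge0.
elim: n => [|n IH].
  rewrite big_geq// mulr_ge0// ?invr_ge0 ?(ltW x10)// subr_ge0.
  by rewrite ge_min lexx.
rewrite big_nat_recr//=; have [un|un] := leP u (2 ^+ n).
  have xu : x ^+ n <= u `^ (- c).
    by rewrite /x -powR_exp2n; apply: ger_powR_base; rewrite // oppr_le0 ltW.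
  have xu' : x ^+ n.+1 <= u `^ (- c).
    by apply: le_trans xu; rewrite exprS ler_piMl ?exprn_ge0 ?(ltW x1).
  move: IH; rewrite (min_idPr xu) (min_idPr xu') mul1r powR_exp2n -/x exprS => IH.
  rewrite -lerBrDr; apply: le_trans IH _.
  by rewrite le_eqVlt; apply/orP; left; apply/eqP; field; rewrite gt_eqF.
rewrite mul0r addr0; apply: le_trans IH _.
rewrite ler_wpM2l ?invr_ge0 ?(ltW x10)// lerD2l lerN2 le_min !ge_min lexx/=.
by apply/orP; right; rewrite exprS ler_piMl ?exprn_ge0 ?(ltW x1).
Qed.

Lemma sum_dyadic c n : 0 < c ->
  \sum_(0 <= k < n) (2 ^+ k) `^ (- c) <= (1 - 2 `^ (- c))^-1.
Proof.
move=> c0; have := @sum_dyadic_above c 1 n c0 ltr01.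
by under eq_bigr do rewrite exp2n_ge1 mul1r; rewrite powR1 mulr1.
Qed.

(* The two regimes of the minimum cross at [2 ^ k = v ^ p]; when
   [alpha = 1/p - 1/q] both sides of the crossing are geometric. *)
Lemma sum_dyadic_min (p q alpha : R) : 1 < p -> p <= q -> 0 < alpha ->
  p^-1 - q^-1 <= alpha ->
  exists2 C : R, 0 < C & forall v n, 1 <= v ->
    \sum_(0 <= k < n) (2 ^+ k) `^ (- alpha) * Num.min v ((2 ^+ k) `^ p^-1)
      <= C * v `^ (p / q).
Proof.
move=> p1 pq a0 apq; have p0 : 0 < p by apply: lt_trans p1.
have q0 : 0 < q by apply: lt_le_trans pq.
move: pq; rewrite le_eqVlt => /predU1P[<-|pq].
  (* For [p = q] the gap [1/p - 1/q] vanishes, and the decay comes from [alpha > 0] alone. *)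
  exists (1 - 2 `^ (- alpha))^-1; first by rewrite invr_gt0 subr_gt0 powR2N_lt1.
  move=> v n v1; rewrite divff ?gt_eqF// powRr1 ?(le_trans ler01)//.
  apply: (@le_trans _ _ (\sum_(0 <= k < n) (2 ^+ k) `^ (- alpha) * v)).
    by apply: ler_sum => k _; rewrite ler_wpM2l ?powR_ge0// ge_min lexx.
  by rewrite -mulr_suml ler_wpM2r ?sum_dyadic// (le_trans ler01).
have d0 : 0 < p^-1 - q^-1 by rewrite subr_gt0 ltf_pV2.
set d := p^-1 - q^-1 in apq d0 *.
pose C1 : R := 2 `^ q^-1 / (2 `^ q^-1 - 1); pose C2 : R := (1 - 2 `^ (- d))^-1.
have C10 : 0 < C1.
  by rewrite divr_gt0 ?powR_gt0// subr_gt0 powR2_gt1// invr_gt0.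
have C20 : 0 < C2 by rewrite invr_gt0 subr_gt0 powR2N_lt1.
exists (C1 + C2) => [|v n v1]; first exact: addr_gt0.
have v0 : 0 < v by apply: lt_le_trans v1.
have e1 : (v `^ p) `^ q^-1 = v `^ (p / q) by rewrite -powRrM.
have e2 : v * (v `^ p) `^ (- d) = v `^ (p / q).
  rewrite -powRrM -{1}(powRr1 (ltW v0)) -powRD; last by rewrite (gt_eqF v0) implybT.
  by congr (_ `^ _); rewrite /d; field; rewrite !gt_eqF.
rewrite mulrDl -{1}e1 -e2 mulrCA [leRHS]addrC.
apply: (@le_trans _ _ (\sum_(0 <= k < n)
    (v * ((v `^ p <= 2 ^+ k)%R%:R * (2 ^+ k) `^ (- d)) +
     (2 ^+ k < v `^ p)%R%:R * (2 ^+ k) `^ q^-1))).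
  apply: ler_sum => k _; have ad : (2 ^+ k) `^ (- alpha) <= (2 ^+ k) `^ (- d) :> R.
    by apply: ler_powR; rewrite ?exp2n_ge1// lerN2.
  have [kv|kv] := leP (v `^ p) (2 ^+ k).
    rewrite mul1r mul0r addr0 [leRHS]mulrC ler_pM ?powR_ge0//.
      by rewrite le_min powR_ge0 (ltW v0).
    by rewrite ge_min lexx.
  rewrite mul0r mulr0 mul1r add0r.
  apply: le_trans (ler_pM (powR_ge0 _ _) _ ad (_ : _ <= (2 ^+ k) `^ p^-1)) _.
  - by rewrite le_min powR_ge0 (ltW v0).
  - by rewrite ge_min lexx orbT.
  rewrite -powRD; last by rewrite (gt_eqF (exp2n_gt0 k)) implybT.
  by rewrite /d opprB subrK.
rewrite big_split/= -mulr_sumr lerD//.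
  by rewrite ler_wpM2l ?(ltW v0)// sum_dyadic_above// powR_gt0.
by rewrite sum_dyadic_below ?invr_gt0 ?powR_ge0.
Qed.

End dyadic_sums.

(** * Quasimetric spaces with linear growth of the measure *)

Section growth_space.
Context {d : measure_display} {X : measurableType d} {R : realType}.
Variables (mu : {measure set X -> \bar R}) (rho : X -> X -> R) (a0 a1 C0 : R).
Hypotheses (a01 : 1 <= a0) (a11 : 1 <= a1) (C00 : 0 < C0).
Hypothesis rho0 : forall x y, 0 <= rho x y.
Hypothesis rho_gt0 : forall x y, x != y -> 0 < rho x y.
Hypothesis rhoxx : forall x, rho x x = 0.
Hypothesis rhoC : forall x y, rho x y <= a0 * rho y x.
Hypothesis rhoD : forall x y z, rho x y <= a1 * (rho x z + rho z y).
Hypothesis mball : forall a r, measurable (qball rho a r).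
Hypothesis growth : forall a r, 0 < r -> (mu (qball rho a r) <= (C0 * r)%:E)%E.
Hypothesis mu1 : forall x, mu [set x] = 0%E.

Let a00 : 0 < a0. Proof. exact: lt_le_trans a01. Qed.
Let a10 : 0 < a1. Proof. exact: lt_le_trans a11. Qed.

(** ** Covering and the maximal function *)

Lemma measure_bigsetU_seq_le (A : X -> set X) (s : seq X) :
  (forall x, measurable (A x)) ->
  (mu (\big[setU/set0]_(x <- s) A x) <= \sum_(x <- s) mu (A x))%E.
Proof.
move=> mA; elim: s => [|x s IH]; first by rewrite !big_nil measure0.
rewrite !big_cons; apply: (@le_trans _ _ (mu (A x) + mu (\big[setU/set0]_(i <- s) A i))%E).
  apply: measureU2 => //.
  by rewrite -bigcup_seq; apply: fin_bigcup_measurable => // i _; exact: mA.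
by rewrite leeD2l.
Qed.

Section covering.
Variables (h : X -> R) (sigma L : R).
Hypotheses (h0 : forall x, 0 <= h x) (mh : measurable_fun setT h).
Hypotheses (sigma0 : 0 < sigma) (L0 : 0 < L).
Hypothesis hfin : (\int[mu]_x (h x)%:E < +oo)%E.

Let r n : R := L / 2 ^+ n.
Let B n x := qball rho x (r n).
Let mass (A : set X) := (\int[mu]_(x in A) (h x)%:E)%E.
Let heavy n x := ((sigma * r n)%:E < mass (B n x))%E.

Let r_gt0 n : 0 < r n. Proof. by rewrite divr_gt0. Qed.

Let mhE (A : set X) : measurable_fun A (fun x => (h x)%:E).
Proof. by apply/measurable_EFinP; exact: measurable_funTS. Qed.

Let pick n (V : set X) : set X := projT1 (ex_maximal_disjoint_subcollection
  (B n) [set x | heavy n x /\ B n x `&` V = set0]).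

Let pickP n V := projT2 (ex_maximal_disjoint_subcollection
  (B n) [set x | heavy n x /\ B n x `&` V = set0]).

(* Greedy selection, one scale at a time from the largest radius down; [V n] is
   the union of the balls selected at the scales before [n]. *)
Let Fixpoint V n : set X :=
  if n is m.+1 then V m `|` \bigcup_(x in pick m (V m)) B m x else set0.

Let F n := pick n (V n).

Let F_heavy n x : F n x -> heavy n x /\ B n x `&` V n = set0.
Proof. by case: (pickP n (V n)) => + _ _; apply. Qed.

Let F_triv n : trivIset (F n) (B n).
Proof. by case: (pickP n (V n)). Qed.

Let ball_center n x : B n x x.
Proof. by rewrite /B /qball/= rhoxx. Qed.

Let V_F n y : V n y -> exists m z, [/\ (m < n)%N, F m z & B m z y].
Proof.
elim: n => [//|n IH] /= [/IH [m [z [mn Fz Bz]]]|[z Fz Bz]].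
  by exists m, z; split => //; exact: ltnW.
by exists n, z.
Qed.

(** Either the ball meets one selected at a larger scale or, missing all of those, it is a candidate
    at scale [n] and by maximality meets a ball of [F n]. *)
Let heavy_meets n x : heavy n x ->
  exists m z, [/\ (m <= n)%N, F m z & B n x `&` B m z !=set0].
Proof.
move=> hx; have [BV|/set0P[y [By /V_F[m [z [mn Fz Bz]]]]]] := eqVneq (B n x `&` V n) set0; last first.
  by exists m, z; split; [exact: ltnW| |exists y].
apply: contrapT => nmeet.
have nz z : F n z -> B n x `&` B n z = set0.
  move=> Fz; apply/eqP/negPn/negP => /set0P ne; apply: nmeet.
  by exists n, z.
have nFx : ~ F n x.
  by move=> /nz; rewrite setIid => E; have := ball_center n x; rewrite E.
have [sub triv /(_ (F n `|` [set x]))] := pickP n (V n); apply.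
- rewrite properEneq; split; last by left.
  by apply/eqP => E; apply: nFx; rewrite /F /pick E; right.
- by move=> z [/sub//|->].
- move=> i j [Fi|->] [Fj|->]// ij; first exact: triv.
  + by move: ij; rewrite setIC nz// => /set0P; rewrite eqxx.
  + by move: ij; rewrite nz// => /set0P; rewrite eqxx.
Qed.

Let mB n x : measurable (B n x). Proof. exact: mball. Qed.

Let mbigB n (s : seq X) : measurable (\big[setU/set0]_(x <- s) B n x).
Proof. by rewrite -bigcup_seq; apply: fin_bigcup_measurable. Qed.

Let mass_seq n (s : seq X) : uniq s -> (forall x, x \in s -> F n x) ->
  (((size s)%:R * (sigma * r n))%:E <= mass (\big[setU/set0]_(x <- s) B n x))%E.
Proof.
move=> us sF; rewrite /mass ge0_integral_bigsetU//; last first.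
- by move=> x _; rewrite lee_fin.
- by move=> i j /= /sF Fi /sF Fj; exact: F_triv.
elim: s sF {us} => [|x s IH] sF; first by rewrite big_nil mul0r.
rewrite big_cons /= -natr1 mulrDl mul1r addrC EFinD leeD//.
  by apply: ltW; have [] := F_heavy (sF x (mem_head _ _)).
by apply: IH => y ys; apply: sF; rewrite in_cons ys orbT.
Qed.

Let mass_le A : measurable A -> (mass A <= \int[mu]_x (h x)%:E)%E.
Proof. by move=> mA; apply: ge0_subset_integral => // x _; rewrite lee_fin. Qed.

(** The selected balls of one scale are disjoint and each carries mass at least [sigma * r n], so a
    finite total mass bounds their number. *)
Let F_fin n : finite_set (F n).
Proof.
apply: contrapT => Finf; have srn : 0 < sigma * r n by rewrite mulr_gt0.
have M0 : (0 <= \int[mu]_x (h x)%:E)%E by apply: integral_ge0 => x _; rewrite lee_fin.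
have Mfin : (\int[mu]_x (h x)%:E)%E \is a fin_num by rewrite ge0_fin_numE.
set M := fine (\int[mu]_x (h x)%:E)%E.
have [s sF Ns] := infinite_set_fset (Num.truncn (M / (sigma * r n))).+1 Finf.
have /= := mass_seq (fset_uniq s) sF.
move=> /le_trans /(_ (mass_le (mbigB n s))).
rewrite -(fineK Mfin) lee_fin -/M -ler_pdivlMr// leNgt => /negP; apply.
apply: lt_le_trans (truncnS_gt _) _.
by rewrite ler_nat.
Qed.

Let s n : seq X := fset_set (F n).

Let sP n x : (x \in s n) <-> F n x.
Proof. by rewrite in_fset_set//; split; [move/set_mem|move/mem_set]. Qed.

Let VS n : V n.+1 = V n `|` \big[setU/set0]_(x <- s n) B n x.
Proof.
rewrite -bigcup_seq /=; congr (_ `|` _); apply: eq_bigcupl; split=> x /=.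
  by move/sP.
by move/sP.
Qed.

Let mV n : measurable (V n).
Proof.
elim: n => [|n IH]; first exact: measurable0.
by rewrite VS; apply: measurableU.
Qed.

(** Balls of [F n] avoid [V n], so masses add across scales as well as within one. *)
Let mass_V n :
  (\sum_(0 <= m < n) ((size (s m))%:R * (sigma * r m))%:E <= mass (V n))%E.
Proof.
elim: n => [|n IH]; first by rewrite big_geq// /mass integral_set0.
rewrite big_nat_recr//= -/(V n.+1) VS /mass ge0_integral_setU//; first last.
- apply/disj_setPS => y [Vy]; rewrite -bigcup_seq => -[x /=].
  move=> /sP /F_heavy[_ E] Bx.
  have : (B n x `&` V n) y by split.
  by rewrite E.
- by move=> x _; rewrite lee_fin.
rewrite leeD//; by apply: mass_seq => [|x /sP//]; exact: fset_uniq.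
Qed.

Lemma vitali_covering : exists U : set X, [/\ measurable U,
  forall n x, ((sigma * (L / 2 ^+ n))%:E <
    \int[mu]_(y in qball rho x (L / 2 ^+ n)) (h y)%:E)%E -> U x &
  (mu U <= (C0 * (a1 * (a0 + 1)) / sigma)%:E * \int[mu]_x (h x)%:E)%E].
Proof.
(* If [B n x] meets at [w] a selected [B m z] of no smaller radius, then [rho x z <= a1 (rho x w +
   rho w z) < a1 (a0 + 1) r m]. *)
pose K := a1 * (a0 + 1).
have K0 : 0 < K by rewrite mulr_gt0// addr_gt0.
have CK : (0 <= (C0 * K / sigma)%:E)%E by rewrite lee_fin; apply/ltW/divr_gt0 => //; exact: mulr_gt0.
pose U n := \big[setU/set0]_(x <- s n) qball rho x (K * r n).
have mU n : measurable (U n).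
  by rewrite /U -bigcup_seq; apply: fin_bigcup_measurable => // i _; exact: mball.
exists (\bigcup_n U n); split; first exact: bigcup_measurable.
- move=> n x /heavy_meets[m [z [mn Fz [w [/= Bxw Bzw]]]]].
  exists m => //; rewrite /U -bigcup_seq; exists z => /=; first exact/sP.
  rewrite /qball/=; apply: le_lt_trans (rhoD x z w) _.
  rewrite /K -mulrA ltr_pM2l// mulrDl mul1r; apply: ler_ltD => //.
  apply: le_trans (rhoC _ _) _; rewrite ler_pM2l//; apply: le_trans (ltW Bxw) _.
  by rewrite /r ler_pM2l// lef_pV2 ?posrE// ler_eXn2l ?ltr1n.
apply: (@le_trans _ _ (\sum_(0 <= n <oo) mu (U n))%E).
  by apply: generalized_Boole_inequality => //; exact: bigcup_measurable.
apply: nneseries_le_ub => // n.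
apply: (@le_trans _ _ ((C0 * K / sigma)%:E * mass (V n))%E); last first.
  by apply: lee_wpmul2l; [exact: CK|exact: mass_le].
apply: (@le_trans _ _ ((C0 * K / sigma)%:E *
    \sum_(0 <= m < n) ((size (s m))%:R * (sigma * r m))%:E)%E); last first.
  by apply: lee_wpmul2l; [exact: CK|exact: mass_V].
rewrite ge0_sume_distrr; last first.
  by move=> i _; rewrite lee_fin !mulr_ge0// ltW.
apply: lee_sum => m _; apply: le_trans (measure_bigsetU_seq_le _ _) _ => //.
rewrite -EFinM; apply: (@le_trans _ _ (\sum_(x <- s m) (C0 * (K * r m))%:E)%E).
  by apply: lee_sum => x _; apply: growth; rewrite mulr_gt0.
rewrite sumEFin lee_fin big_const_seq count_predT iter_addr_0 -mulr_natl.
by rewrite le_eqVlt; apply/orP; left; apply/eqP; field; rewrite gt_eqF.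
Qed.

End covering.

Section maximal_majorant.
Let K := a1 * (a0 + 1).
Let K0 : 0 < K. Proof. by rewrite mulr_gt0// addr_gt0. Qed.

(* [H x] plays the role of [max 1 (M g x / G)] to the power [p], where [M] is the
   maximal function over the radii [L / 2 ^ n]; unlike the latter, it is measurable. *)
Lemma maximal_majorant (p : R) : 1 < p -> exists2 C : R, 0 < C &
  forall (g : X -> R) (G L : R), (forall x, 0 <= g x) -> measurable_fun setT g ->
    0 < G -> 0 < L -> (\int[mu]_x (g x `^ p)%:E < +oo)%E ->
    exists H : X -> \bar R, [/\ forall x, (0 <= H x)%E, measurable_fun setT H,
      forall x, (H x < +oo)%E -> exists2 v : R, 1 <= v &
        ((v `^ p)%:E <= H x)%E /\
        forall n, (\int[mu]_(y in qball rho x (L / 2 ^+ n)) (g y)%:E <=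
          (G * v * (L / 2 ^+ n))%:E)%E &
      forall E, measurable E -> (\int[mu]_(x in E) H x <=
        mu E + (C * G `^ (- p))%:E * \int[mu]_x (g x `^ p)%:E)%E].
Proof.
move=> p1; have p0 : 0 < p by apply: lt_trans p1.
have p10 : 0 < p - 1 by rewrite subr_gt0.
pose Cp : R := 2 `^ (p - 1) / (2 `^ (p - 1) - 1).
have Cp0 : 0 < Cp by rewrite divr_gt0 ?powR_gt0// subr_gt0 powR2_gt1.
pose A : R := 2 * 2 `^ p * C0 * K.
have A0 : 0 < A.
  by apply: mulr_gt0 => //; apply: mulr_gt0 => //; apply: mulr_gt0 => //; exact: powR_gt0.
pose C : R := A * Cp * (2 * C0) `^ (p - 1).
have C20 : 0 < 2 * C0 by rewrite mulr_gt0.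
exists C; first by apply: mulr_gt0; [exact: mulr_gt0|exact: powR_gt0].
move=> g G L g0 mg G0 L0 gfin.
(* The part of [g] below [t k] contributes at most [t k * C0 * r = G * 2 ^ k * r / 2] to a ball of
   radius [r], half of the bound wanted in [outside]; the other half comes from the threshold
   [sigma] of the covering. *)
pose t k : R := G * 2 ^+ k / (2 * C0).
have t0 k : 0 < t k by rewrite /t divr_gt0// mulr_gt0.
pose h k x : R := (t k < g x)%R%:R * g x.
have h0 k x : 0 <= h k x by rewrite mulr_ge0.
have mh k : measurable_fun setT (h k).
  have -> : h k = fun x => if t k < g x then g x else 0.
    by apply/funext => x; rewrite /h; case: ltP => _; rewrite ?mul1r ?mul0r.
  by apply: measurable_fun_ifT => //; exact: measurable_fun_ltr.
have mhE k D : measurable_fun D (fun x => (h k x)%:E).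
  by apply/measurable_EFinP; exact: measurable_funTS.
have mgp D : measurable_fun D (fun x => (g x `^ p)%:E).
  apply/measurable_EFinP; apply: measurable_funTS.
  exact: (measurableT_comp (measurable_powR p) mg).
(* This makes [h k] integrable as soon as [g ^ p] is. *)
have hgp k x : h k x <= t k `^ (1 - p) * g x `^ p.
  rewrite /h; have [tg|] := ltP (t k) (g x); last first.
    by rewrite mul0r mulr_ge0// powR_ge0.
  have gx0 : 0 < g x by apply: lt_trans tg.
  rewrite mul1r -[leLHS]mul1r -(mulr_powRB1 (g0 x) p0) mulrCA [leRHS]mulrC.
  rewrite ler_wpM2r// -opprB powRN mulrC ler_pdivlMr ?powR_gt0// mul1r.
  by apply: ler_powR_base; rewrite ltW.
have hfin k : (\int[mu]_x (h k x)%:E < +oo)%E.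
  apply: (@le_lt_trans _ _ (\int[mu]_x ((t k `^ (1 - p))%:E * (g x `^ p)%:E))%E).
    by apply: ge0_le_lower_integral => x _; rewrite ?lee_fin// -EFinM lee_fin.
  rewrite ge0_integralZl//; last 2 first.
  - by move=> x _; rewrite lee_fin powR_ge0.
  - by rewrite lee_fin powR_ge0.
  by rewrite lte_mul_pinfty// ?lee_fin ?powR_ge0.
have s0 k : 0 < G * 2 ^+ k / 2 by rewrite divr_gt0 ?mulr_gt0.
have /choice[U HU] := fun k => vitali_covering (h0 k) (mh k) (s0 k) L0 (hfin k).
have mU k : measurable (U k) by case: (HU k).
pose T k x : \bar R := (((2 ^+ k.+1) `^ p)%:E * (\1_(U k) x)%:E)%E.
have T0 k x : (0 <= T k x)%E by rewrite mule_ge0// lee_fin ?powR_ge0.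
have mT k D : measurable_fun D (T k).
  apply: measurable_funeM; apply/measurable_EFinP.
  by apply: measurable_funTS; exact: measurable_indic.
(* The weight on [U k] is built from [2 ^ (k + 1)] because a point whose first missed set is
   [U (k + 1)] lies in [U k] and is given [v = 2 ^ (k + 1)]. *)
pose H x : \bar R := (1 + \sum_(0 <= k <oo) T k x)%E.
have HU1 x : (1 <= H x)%E by rewrite leeDl// nneseries_ge0.
have HUk k x : U k x -> (((2 ^+ k.+1) `^ p)%:E <= H x)%E.
  move=> Ux; apply: (@le_trans _ _ (T k x)).
    by rewrite /T indicE mem_set//= mule1.
  rewrite /H; apply: (@le_trans _ _ (\sum_(0 <= k <oo) T k x)%E); last by rewrite leeDr.
  apply: (le_trans _ (nneseries_lim_ge k.+1 _)) => //.
  by rewrite big_nat_recr//= leeDr// sume_ge0.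
have outside k x n : ~ U k x ->
    (\int[mu]_(y in qball rho x (L / 2 ^+ n)) (g y)%:E <=
          (G * 2 ^+ k * (L / 2 ^+ n))%:E)%E.
  move=> nU; have r0 : 0 < L / 2 ^+ n by rewrite divr_gt0.
  set r := L / 2 ^+ n in r0 *.
  apply: (@le_trans _ _ (\int[mu]_(y in qball rho x r) ((h k y)%:E + (t k)%:E))%E).
    apply: ge0_le_lower_integral => y _; rewrite lee_fin// /h.
    by have [_|] := ltP (t k) (g y); rewrite ?mul1r ?mul0r ?add0r// lerDl ltW.
  rewrite ge0_integralD//; last 2 first.
  - by move=> y _; rewrite lee_fin.
  - by move=> y _; rewrite lee_fin ltW.
  rewrite integral_cst//.
  have -> : (G * 2 ^+ k * r)%:E = ((G * 2 ^+ k / 2 * r)%:E + (t k * (C0 * r))%:E)%E.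
    by rewrite -EFinD /t; congr _%:E; field; rewrite gt_eqF.
  apply: leeD.
    by rewrite leNgt; apply/negP; case: (HU k) => _ + _ => /[apply].
  rewrite [leRHS]EFinM; apply: lee_wpmul2l; last exact: growth.
  by rewrite lee_fin ltW.
exists H; split=> [x||x Hx|E mE].
- exact: le_trans (HU1 x).
- by apply: emeasurable_funD => //; exact: ge0_emeasurable_sum.
(* If [x] lay in every [U k], then [H x] would be at least every [2 ^ ((k + 1) p)], hence
   infinite. *)
- have [k nUk] : exists k, ~ U k x.
    apply/existsNP => allU; have Hf : H x \is a fin_num.
      by rewrite ge0_fin_numE// (le_trans _ (HU1 x)).
    have := HUk (Num.truncn (fine (H x))) x (allU _).
    rewrite -(fineK Hf) lee_fin leNgt => /negP; apply.
    apply: lt_le_trans (truncnS_gt _) _; rewrite fineK//.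
    set m := (Num.truncn _).+1; apply: le_trans (le1r_powR (exp2n_ge1 _) (ltW p1)).
    by rewrite -natrX ler_nat ltnW// ltn_expl.
  have [[|j] [nUj Uj]] : exists j, ~ U j x /\ forall i, (i < j)%N -> U i x.
    elim/ltn_ind: k nUk => k IH nUk.
    have [|] := pselect (exists2 i, (i < k)%N & ~ U i x).
      by case=> i ik /(IH _ ik).
    by move=> nex; exists k; split => // i ik; apply: contrapT => ?; apply: nex; exists i.
  + exists 1; rewrite ?powR1//; split=> // n.
    by have := outside _ _ n nUj; rewrite expr0.
  + exists (2 ^+ j.+1); first exact: exp2n_ge1.
    split; first by apply: HUk; exact: Uj.
    by move=> n; exact: outside.
- rewrite ge0_integralD//; last 2 first.
  + by move=> x _; exact: nneseries_ge0.
  + exact: ge0_emeasurable_sum.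
  rewrite integral_cst// mul1e leeD2l//.
  rewrite integral_nneseries//.
  (* The covering bounds [mu (U k)] by a constant times the integral of [h k] over [G * 2 ^ k],
     which lowers the exponent of [2 ^ k] from [p] to [p - 1]. *)
  apply: (@le_trans _ _ (\sum_(0 <= k <oo)
      ((A / G)%:E * \int[mu]_x (((2 ^+ k) `^ (p - 1))%:E * (h k x)%:E)))%E).
    apply: lee_nneseries => [k _ _|k _]; first exact: integral_ge0.
    rewrite /T ge0_integralZl//; last first.
      by apply/measurable_EFinP; apply: measurable_funTS; exact: measurable_indic.
    rewrite integral_indic//.
    apply: (@le_trans _ _ (((2 ^+ k.+1) `^ p)%:E * mu (U k))%E).
      apply: lee_wpmul2l; first by rewrite lee_fin powR_ge0.
      by apply: le_measure; [apply/mem_set; exact: measurableI|exact/mem_set/mU|exact: subIsetl].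
    have [_ _ HUm] := HU k.
    apply: (@le_trans _ _ (((2 ^+ k.+1) `^ p)%:E *
       ((C0 * (a1 * (a0 + 1)) / (G * 2 ^+ k / 2))%:E * \int[mu]_x (h k x)%:E))%E).
      by apply: lee_wpmul2l => //; rewrite lee_fin powR_ge0.
    rewrite ge0_integralZl//; last by move=> x _; rewrite lee_fin.
    rewrite !muleA -!EFinM le_eqVlt; apply/orP; left; apply/eqP.
    congr (_%:E * _)%E.
    have -> : (2 ^+ k.+1) `^ p = 2 `^ p * (2 ^+ k * (2 ^+ k) `^ (p - 1)) :> R.
      by rewrite exprS powRM// mulr_powRB1// exprn_ge0.
    by rewrite /A /K; field; rewrite !gt_eqF.
  rewrite nneseriesZl; last by move=> k _; apply: integral_ge0 => x _;
    rewrite mule_ge0// lee_fin ?powR_ge0.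
  rewrite -integral_nneseries//; last 2 first.
  + by move=> k; exact: measurable_funeM.
  + by move=> k x _; rewrite mule_ge0// lee_fin ?powR_ge0.
  (* With the sum now inside the integral, only the [k] with [2 ^ k < 2 C0 g x / G] contribute at
     [x], and their geometric sum restores the power [g x ^ p]. *)
  apply: (@le_trans _ _ ((A / G)%:E *
     \int[mu]_x ((Cp * (2 * C0 / G) `^ (p - 1))%:E * (g x `^ p)%:E))%E).
    apply: lee_wpmul2l; first by rewrite lee_fin ltW// divr_gt0.
    apply: ge0_le_lower_integral => x _.
      by apply: nneseries_ge0 => k _ _; rewrite mule_ge0// lee_fin ?powR_ge0.
    apply: nneseries_le_ub => n.
      by rewrite mule_ge0// lee_fin ?powR_ge0.
    under eq_bigr do rewrite -EFinM.
    rewrite sumEFin -EFinM lee_fin.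
    apply: (@le_trans _ _ (g x * (Cp * (2 * C0 / G * g x) `^ (p - 1)))); last first.
      rewrite powRM ?(ltW (divr_gt0 C20 G0))// -(mulr_powRB1 (g0 x) p0).
      by rewrite le_eqVlt; apply/orP; left; apply/eqP; ring.
    have u0 : 0 <= 2 * C0 / G * g x by rewrite mulr_ge0// ltW// divr_gt0.
    apply: le_trans (ler_wpM2l (g0 x) (sum_dyadic_below n p10 u0)).
    rewrite mulr_sumr; apply: ler_sum => k _.
    have tE : (t k < g x) = (2 ^+ k < 2 * C0 / G * g x).
      by rewrite /t ltr_pdivrMr// [in RHS]mulrAC ltr_pdivlMr// mulrC [g x * _]mulrC.
    by rewrite /h tE le_eqVlt; apply/orP; left; apply/eqP; ring.
  rewrite ge0_integralZl//; last 2 first.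
  + by move=> x _; rewrite lee_fin powR_ge0.
  + by rewrite lee_fin mulr_ge0 ?powR_ge0// ltW.
  rewrite muleA -EFinM le_eqVlt; apply/orP; left; apply/eqP.
  congr (_%:E * _)%E.
  rewrite /C powRM ?(ltW C20) ?invr_ge0 ?(ltW G0)//.
  have -> : G `^ (- p) = G^-1 * G^-1 `^ (p - 1).
    rewrite mulr_powRB1 ?invr_ge0 ?(ltW G0)//.
    by rewrite -(powR_inv1 (ltW G0)) -powRrM mulN1r.
  ring.
Qed.

End maximal_majorant.

(** ** Dyadic shells and the kernel *)

Definition shell a s t : set X := qball rho a t `\` qball rho a s.

Lemma shellP a s t y : shell a s t y <-> s <= rho y a /\ rho y a < t.
Proof.
rewrite /shell /qball /=; split=> [[? /negP]|[? ?]]; first by rewrite -leNgt.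
by split=> //; apply/negP; rewrite -leNgt.
Qed.

Lemma measurable_shell a s t : measurable (shell a s t).
Proof. exact: measurableD. Qed.

(** The centre of a ball lies in none of its dyadic shells and must be set aside as a null set,
    which requires it to be measurable. *)
Lemma measurable_point (x : X) : measurable [set x].
Proof.
have -> : [set x] = \bigcap_n qball rho x n.+1%:R^-1.
  apply/seteqP; split=> [y -> n _|y H]/=; first by rewrite /qball/= rhoxx.
  apply/eqP/negPn/negP => /rho_gt0 yx.
  have := H (Num.truncn (rho y x)^-1) I.
  rewrite /qball/= => /ltW; rewrite leNgt => /negP; apply.
  by rewrite invf_plt ?posrE//; exact: truncnS_gt.
exact: bigcapT_measurable.
Qed.

(** With [|b|] in the exponent of [W] one statement serves both signs: for negative [b] the power
    decreases and the two bounds on [x] exchange roles. *)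
Lemma powR_comparable (W S x b : R) : 1 <= W -> 0 < S -> S / W <= x -> x <= W * S ->
  W `^ (- `|b|) * S `^ b <= x `^ b /\ x `^ b <= W `^ `|b| * S `^ b.
Proof.
move=> W1 S0 lx ux; have W0 : 0 < W by exact: lt_le_trans W1.
have x0 : 0 < x by apply: lt_le_trans lx; rewrite divr_gt0.
have [x0' S0' W0'] := And3 (ltW x0) (ltW S0) (ltW W0).
have lx' : S <= x * W by rewrite -ler_pdivrMr.
have [b0|b0] := leP 0 b.
- rewrite (ger0_norm b0) powRN -powRM//; split; last exact: ler_powR_base.
  rewrite mulrC ler_pdivrMr ?powR_gt0// -powRM//; exact: ler_powR_base.
- rewrite (ltr0_norm b0) opprK powRN -powRM//; split.
    by apply: ger_powR_base => //; exact: ltW.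
  rewrite mulrC ler_pdivlMr ?powR_gt0// -powRM//.
  by apply: ger_powR_base => //; exact: ltW.
Qed.

Lemma ler_powR_add (u t p : R) : 0 <= u -> 0 < t -> 1 < p ->
  u <= t `^ (1 - p) * u `^ p + t.
Proof.
move=> u0 t0 p1; have [ut|tu] := leP u t.
  by rewrite ler_wpDl// mulr_ge0 ?powR_ge0.
rewrite ler_wpDr ?(ltW t0)//; have p0 : 0 < p by apply: lt_trans p1.
rewrite -(mulr_powRB1 u0 p0) mulrCA ler_peMr// -opprB powRN mulrC.
rewrite ler_pdivlMr ?powR_gt0// mul1r.
by apply: ler_powR_base; [rewrite subr_ge0 ltW|exact: ltW|exact: ltW].
Qed.

Lemma lee_scale (c M : R) (I : \bar R) : 0 < c -> (c%:E * I <= M%:E)%E ->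
  (I <= (c^-1 * M)%:E)%E.
Proof.
move=> c0 cI; apply: (@le_trans _ _ ((c^-1)%:E * (c%:E * I))%E).
  by rewrite muleA -EFinM mulVf ?gt_eqF// mul1e.
by rewrite EFinM; apply: lee_wpmul2l => //; rewrite lee_fin invr_ge0 ltW.
Qed.

(** A substitute for Hoelder's inequality with a free level [t]: where [g] exceeds [t] it is at most
    [t ^ (1 - p) * g ^ p]. For positive [M] and [m], both terms equal the Hoelder bound at
    [t = (M / m) ^ (1 / p)]. *)
Lemma integral_le_of_Lp (p : R) (g : X -> R) (A : set X) (t M m : R) :
  1 < p -> (forall x, 0 <= g x) -> measurable_fun setT g -> measurable A -> 0 < t ->
  (\int[mu]_(x in A) (g x `^ p)%:E <= M%:E)%E -> (mu A <= m%:E)%E ->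
  (\int[mu]_(x in A) (g x)%:E <= (t `^ (1 - p) * M + t * m)%:E)%E.
Proof.
move=> p1 g0 mg mA t0 gM Am.
have mgp : measurable_fun A (fun x => (g x `^ p)%:E).
  apply/measurable_EFinP; apply: measurable_funTS.
  exact: (measurableT_comp (measurable_powR p) mg).
apply: (@le_trans _ _ (\int[mu]_(x in A)
    ((t `^ (1 - p))%:E * (g x `^ p)%:E + t%:E))%E).
  apply: ge0_le_lower_integral => x _; rewrite lee_fin//.
  exact: ler_powR_add.
rewrite ge0_integralD//; first last.
- by move=> x _; rewrite lee_fin ltW.
- exact: measurable_funeM.
- by move=> x _; rewrite mule_ge0// lee_fin powR_ge0.
rewrite ge0_integralZl//; first last.
- by rewrite lee_fin powR_ge0.
- by move=> x _; rewrite lee_fin powR_ge0.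
rewrite integral_cst// EFinD !EFinM leeD//.
  by apply: lee_wpmul2l => //; rewrite lee_fin powR_ge0.
by apply: lee_wpmul2l => //; rewrite lee_fin ltW.
Qed.

Lemma integral_qball_le (a : X) (L M : R) (h : X -> \bar R) (u : nat -> R) :
  0 < L -> (forall x, (0 <= h x)%E) ->
  (forall n, (\int[mu]_(x in shell a (L / 2 ^+ n.+1) (L / 2 ^+ n)) h x <= (u n)%:E)%E) ->
  (forall n, \sum_(0 <= k < n) u k <= M) ->
  (\int[mu]_(x in qball rho a L) h x <= M%:E)%E.
Proof.
move=> L0 h0 hu uM; pose D n := shell a (L / 2 ^+ n.+1) (L / 2 ^+ n).
have cover : qball rho a L `<=` [set a] `|` \bigcup_n D n.
  move=> y; rewrite {1}/qball/= => yL.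
  have [->|ya] := eqVneq y a; first by left.
  right; have y0 := rho_gt0 ya.
  have [n rn] : exists n, L / 2 ^+ n <= rho y a.
    exists (Num.truncn (L / rho y a)).+1.
    rewrite ler_pdivrMr// mulrC -ler_pdivrMr//.
    apply: ltW; apply: lt_le_trans (truncnS_gt _) _.
    by rewrite -natrX ler_nat ltnW// ltn_expl.
  (* The first radius not exceeding [rho y a] has an index [n.+1], index 0 being excluded by [yL];
     then [y] lies in [D n]. *)
  elim: n rn => [|n IH] rn.
    by move: rn; rewrite leNgt expr0 divr1 yL.
  have [rn'|] := leP (L / 2 ^+ n) (rho y a); first exact: IH.
  by exists n => //; apply/shellP.
have mD n : measurable (D n) by exact: measurable_shell.
apply: le_trans (ge0_lower_subset_integral mu (fun x _ => h0 x) cover) _.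
apply: le_trans (lower_integral_setU _ h0 (measurable_point a) (bigcup_measurable (fun n _ => mD n))) _.
rewrite (lower_integral_null h0 (measurable_point a) (mu1 a)) add0e.
apply: le_trans (lower_integral_bigcup mu h0 mD (@subset_refl _ _)) _.
apply: nneseries_le_ub => [n|n]; first exact: integral_ge0.
apply: (@le_trans _ _ (\sum_(0 <= k < n) (u k)%:E)%E).
  by apply: lee_sum => k _; exact: hu.
by rewrite sumEFin lee_fin.
Qed.

Lemma integral_setC_qball_le (a : X) (S M : R) (h : X -> \bar R) (u : nat -> R) :
  0 < S -> (forall x, (0 <= h x)%E) ->
  (forall n, (\int[mu]_(x in shell a (S * 2 ^+ n) (S * 2 ^+ n.+1)) h x <= (u n)%:E)%E) ->
  (forall n, \sum_(0 <= k < n) u k <= M) ->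
  (\int[mu]_(x in ~` qball rho a S) h x <= M%:E)%E.
Proof.
move=> S0 h0 hu uM; pose D n := shell a (S * 2 ^+ n) (S * 2 ^+ n.+1).
have cover : ~` qball rho a S `<=` \bigcup_n D n.
  move=> y; rewrite {1}/qball/= => /negP; rewrite -leNgt => Sy.
  have [n rn] : exists n, rho y a < S * 2 ^+ n.
    exists (Num.truncn (rho y a / S)).+1.
    rewrite mulrC -ltr_pdivrMr//; apply: lt_le_trans (truncnS_gt _) _.
    by rewrite -natrX ler_nat ltnW// ltn_expl.
  elim: n rn => [|n IH] rn.
    by move: rn; rewrite ltNge expr0 mulr1 Sy.
  have [|rn'] := ltP (rho y a) (S * 2 ^+ n); first exact: IH.
  by exists n => //; apply/shellP.
have mD n : measurable (D n) by exact: measurable_shell.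
apply: le_trans (ge0_lower_subset_integral mu (fun x _ => h0 x) cover) _.
apply: le_trans (lower_integral_bigcup mu h0 mD (@subset_refl _ _)) _.
apply: nneseries_le_ub => [n|n]; first exact: integral_ge0.
apply: (@le_trans _ _ (\sum_(0 <= k < n) (u k)%:E)%E).
  by apply: lee_sum => k _; exact: hu.
by rewrite sumEFin lee_fin.
Qed.

Lemma kernel_le (alpha W t x : R) : alpha < 1 -> 0 < W -> 0 < t -> t / W <= x ->
  x `^ (alpha - 1) <= W `^ (1 - alpha) * t `^ (alpha - 1).
Proof.
move=> al1 W0 t0 tx; apply: le_trans (ger_powR_base _ _ tx) _.
- by rewrite subr_le0 ltW.
- exact: divr_gt0.
rewrite powRM ?invr_ge0 ?(ltW W0) ?(ltW t0)// mulrC ler_wpM2r ?powR_ge0//.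
by rewrite -(powR_inv1 (ltW W0)) -powRrM mulN1r opprB.
Qed.

(** * The potential near the point of evaluation *)

Section near.
Variables p q alpha : R.
Hypotheses (p1 : 1 < p) (pq : p <= q) (al0 : 0 < alpha) (al1 : alpha < 1).
Hypothesis apq : p^-1 - q^-1 <= alpha.

(* Hedberg's pointwise bound: on the ball of radius [L / 2 ^ n] the mean of [g] is
   controlled both by the maximal function and, through the p-norm, by [2 ^ (n / p)]. *)
Lemma near_potential (C1 : R) : 0 < C1 -> exists2 C : R, 0 < C &
  forall (g : X -> R) (G L : R) (x : X) (v : R),
    (forall x, 0 <= g x) -> measurable_fun setT g -> 0 < G -> 0 < L -> 1 <= v ->
    (\int[mu]_x (g x `^ p)%:E <= (C1 * G `^ p * L)%:E)%E ->
    (forall n, (\int[mu]_(y in qball rho x (L / 2 ^+ n)) (g y)%:E <=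
          (G * v * (L / 2 ^+ n))%:E)%E) ->
    (\int[mu]_(y in qball rho x L) (g y * rho x y `^ (alpha - 1))%:E <=
      (C * G * L `^ alpha * v `^ (p / q))%:E)%E.
Proof.
move=> C10; have [C4 C40 sumC4] := sum_dyadic_min p1 pq al0 apq.
have p0 : 0 < p by apply: lt_trans p1.
(* The summand 1 serves the maximal bound; [C1] and [C0] come from the p-norm and the measure of the
   ball in the other bound. *)
pose C2 := 1 + C1 + C0; have C20 : 0 < C2 by rewrite !addr_gt0.
pose C3 := (2 * a0) `^ (1 - alpha) * C2.
have C30 : 0 < C3.
  by apply: mulr_gt0 => //; apply: powR_gt0; exact: mulr_gt0.
exists (C3 * C4) => [|g G L x v g0 mg G0 L0 v1 gp Mg]; first exact: mulr_gt0.
have v0 : 0 < v by apply: lt_le_trans v1.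
have [r rE] : exists r : nat -> R, forall n, L / 2 ^+ n = r n by eexists.
have r0 n : 0 < r n by rewrite -rE divr_gt0.
have [G0' L0' v0'] := And3 (ltW G0) (ltW L0) (ltW v0).
have r0' n : 0 <= r n by exact: ltW.
have mgp A : measurable_fun A (fun x => (g x `^ p)%:E).
  apply/measurable_EFinP; apply: measurable_funTS.
  exact: (measurableT_comp (measurable_powR p) mg).
have mgE A : measurable_fun A (fun x => (g x)%:E).
  by apply/measurable_EFinP; apply: measurable_funTS.
have bn n : (\int[mu]_(y in qball rho x (r n)) (g y)%:E <=
    (C2 * G * r n * Num.min v ((2 ^+ n) `^ p^-1))%:E)%E.
  have [_|_] := leP v ((2 ^+ n) `^ p^-1).
    apply: le_trans (_ : _ <= (G * v * r n)%:E)%E _; first by rewrite -rE; exact: Mg.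
    rewrite lee_fin -!mulrA [v * _]mulrC.
    by rewrite ler_peMl ?mulr_ge0// /C2 -addrA ler_wpDr// addr_ge0// ltW.
  (* The level [G * z] balances the two terms: [z ^ p = 2 ^ n] is the ratio of [L] to the radius, so
     both are multiples of [G * r n * z]. *)
  set z := _ `^ p^-1; have z0 : 0 < z by rewrite powR_gt0.
  have zp : z `^ p = 2 ^+ n by rewrite /z -powRrM mulVf ?gt_eqF// powRr1.
  have t0 : 0 < G * z by rewrite mulr_gt0.
  apply: le_trans (@integral_le_of_Lp p g _ (G * z) (C1 * G `^ p * L) (C0 * r n) p1 g0 mg _ t0 _ _) _ => //.
  - apply: le_trans gp; apply: ge0_subset_integral => // y _.
    by rewrite lee_fin powR_ge0.
  - exact: growth.
  have -> : (G * z) `^ (1 - p) * (C1 * G `^ p * L) = C1 * G * r n * z.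
    rewrite powRM ?(ltW z0)// -rE -zp.
    have e y : 0 < y -> y `^ (1 - p) = y / y `^ p.
      by move=> y0; rewrite powRB ?powRr1 ?(ltW y0)// (gt_eqF y0) implybT.
    by rewrite !e//; field; rewrite !gt_eqF ?powR_gt0.
  rewrite lee_fin /C2 -subr_ge0.
  have -> : (1 + C1 + C0) * G * r n * z - (C1 * G * r n * z + G * z * (C0 * r n)) =
    G * r n * z by ring.
  by rewrite !mulr_ge0// ltW.
have k0 y : (0 <= (g y * rho x y `^ (alpha - 1))%:E)%E.
  by rewrite lee_fin mulr_ge0 ?powR_ge0.
apply: (@integral_qball_le x L _ _ (fun k => C3 * G * L `^ alpha *
    ((2 ^+ k) `^ (- alpha) * Num.min v ((2 ^+ k) `^ p^-1)))) => // [n|k]; last first.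
  rewrite -mulr_sumr.
  have -> : C3 * C4 * G * L `^ alpha * v `^ (p / q) =
    C3 * G * L `^ alpha * (C4 * v `^ (p / q)) by ring.
  by apply: ler_wpM2l; [rewrite !mulr_ge0 ?powR_ge0// ltW|exact: sumC4].
rename n into k; rewrite !rE.
have w0 : 0 <= (2 * a0) `^ (1 - alpha) * r k `^ (alpha - 1) by rewrite mulr_ge0 ?powR_ge0.
apply: (@le_trans _ _ (\int[mu]_(y in shell x (r k.+1) (r k))
  (((2 * a0) `^ (1 - alpha) * r k `^ (alpha - 1))%:E * (g y)%:E))%E).
  apply: ge0_le_lower_integral => // y /shellP[ry _].
  rewrite lee_fin mulrC ler_wpM2r//.
  (* The shell controls [rho y x]; passing to [rho x y] costs the factor [a0]. *)
  have xy : r k / (2 * a0) <= rho x y.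
    rewrite ler_pdivrMr ?mulr_gt0//; have := rhoC y x.
    move: ry; rewrite -!rE exprS invfM mulrCA => ry yx.
    have : 2^-1 * (L / 2 ^+ k) <= a0 * rho x y by exact: le_trans yx.
    by rewrite ler_pdivrMl// => /le_trans; apply; rewrite mulrA mulrC.
  by apply: kernel_le => //; exact: mulr_gt0.
rewrite ge0_integralZl//; first last.
- by move=> y _; rewrite lee_fin.
- exact: measurable_shell.
apply: (@le_trans _ _ (((2 * a0) `^ (1 - alpha) * r k `^ (alpha - 1))%:E *
   (C2 * G * r k * Num.min v ((2 ^+ k) `^ p^-1))%:E)%E).
  apply: lee_wpmul2l => //; apply: le_trans (bn k).
  apply: ge0_subset_integral => //; [exact: measurable_shell|by move=> y _; rewrite lee_fin|exact: subDsetl].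
rewrite -EFinM lee_fin le_eqVlt; apply/orP; left; apply/eqP.
have E : L `^ alpha * (2 ^+ k) `^ (- alpha) = r k * r k `^ (alpha - 1).
  rewrite mulr_powRB1// -rE powRM ?invr_ge0// powRN; congr (_ * _).
  by rewrite -[in RHS]powR_inv1// -powRrM mulN1r powRN.
transitivity (C3 * G * (L `^ alpha * (2 ^+ k) `^ (- alpha)) * Num.min v ((2 ^+ k) `^ p^-1)); last by ring.
by rewrite E /C3; ring.
Qed.
End near.

(** ** Functions in a Morrey space *)

Section morrey.
Variables p q alpha beta lambda1 lambda2 gamma : R.
Hypotheses (p1 : 1 < p) (pq : p <= q) (al0 : 0 < alpha) (al1 : alpha < 1).
Hypothesis apq : p^-1 - q^-1 <= alpha.
Hypotheses (betap : beta < p - 1) (l10 : 0 < lambda1).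
Hypothesis l1b : lambda1 < beta - alpha * p + 1.
Hypothesis l12 : lambda1 * q = lambda2 * p.
Hypothesis gammaE : gamma = q * (p^-1 + beta / p - alpha) - 1.

(** The Morrey norm is compared with [N] in p-th powers and without the supremum, so that [N] may
    exceed the norm. *)
Definition morrey_bound (f : X -> R) (N : R) := forall a r, 0 < r ->
  (\int[mu]_(y in qball rho a r) (`|f y| `^ p * rho a y `^ beta)%:E <=
    (N `^ p * r `^ lambda1)%:E)%E.

(* A function of Morrey norm [N] has typical size [N * S `^ kappa] at distance [S]
   from any centre. *)
Let kappa := (lambda1 - beta - 1) / p.

Let p0 : 0 < p. Proof. exact: lt_trans p1. Qed.
Let q0 : 0 < q. Proof. exact: lt_le_trans pq. Qed.

(** Here [lambda1 > 0] and [beta < p - 1] enter; this exponent makes the shell sums converge towards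
    the centre. *)
Let kappa1 : 0 < kappa + 1.
Proof.
have -> : kappa + 1 = (lambda1 + (p - 1 - beta)) / p.
  by rewrite /kappa; field; rewrite gt_eqF.
by rewrite divr_gt0// addr_gt0// subr_gt0.
Qed.

(** Here the upper bound on [lambda1] enters; this exponent makes the shell sums converge at
    infinity. *)
Let kappa_alpha : kappa + alpha < 0.
Proof.
have -> : kappa + alpha = (lambda1 - (beta - alpha * p + 1)) / p.
  by rewrite /kappa; field; rewrite gt_eqF.
by rewrite pmulr_llt0 ?invr_gt0// subr_lt0.
Qed.

Let mabs (f : X -> R) : measurable_fun setT f -> measurable_fun setT (fun x => `|f x|).
Proof. by move=> mf; exact: measurableT_comp. Qed.

Let mpow (f : X -> R) A : measurable_fun setT f ->
  measurable_fun A (fun x => (`|f x| `^ p)%:E).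
Proof.
move=> mf; apply/measurable_EFinP; apply: measurable_funTS.
exact: (measurableT_comp (measurable_powR p) (mabs mf)).
Qed.

(** On a shell the weight is comparable to [S ^ beta] and can be divided out, leaving [S ^ (lambda1
    - beta) = S ^ (kappa * p) * S]. The ratio [V] includes [a0] because the shell bounds [rho y a]
    while the weight uses [rho a y]. *)
Lemma shell_Lp (W : R) : 1 <= W -> exists2 C : R, 0 < C &
  forall f N a S, measurable_fun setT f -> 0 < N -> morrey_bound f N -> 0 < S ->
    (\int[mu]_(y in shell a (S / W) S) (`|f y| `^ p)%:E <=
      (C * (N * S `^ kappa) `^ p * S)%:E)%E.
Proof.
move=> W1; have W0 : 0 < W by exact: lt_le_trans W1.
pose V := W * a0; have V1 : 1 <= V by rewrite /V -[leLHS]mulr1 ler_pM.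
have V0 : 0 < V by exact: lt_le_trans V1.
pose c := V `^ (- `|beta|); have c0 : 0 < c by exact: powR_gt0.
exists c^-1; first by rewrite invr_gt0.
move=> f N a S mf N0 fN S0; have Sb0 : 0 < S `^ beta by exact: powR_gt0.
have mS : measurable (shell a (S / W) S) by exact: measurable_shell.
have cS0 : 0 < c * S `^ beta by exact: mulr_gt0.
have -> : c^-1 * (N * S `^ kappa) `^ p * S =
    (c * S `^ beta)^-1 * (N `^ p * S `^ lambda1).
  rewrite powRM ?powR_ge0 ?(ltW N0)// -powRrM /kappa mulfVK ?gt_eqF//.
  rewrite -addrA powRD; last by rewrite (gt_eqF S0) implybT.
  rewrite -opprD powRN powRD; last by rewrite (gt_eqF S0) implybT.
  rewrite powRr1 ?(ltW S0)//; field.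
  by rewrite !gt_eqF.
apply: lee_scale => //; rewrite -ge0_integralZl//; first last.
- by rewrite lee_fin ltW.
- exact: mpow.
apply: le_trans (fN a S S0).
apply: (@le_trans _ _ (\int[mu]_(y in shell a (S / W) S)
   (`|f y| `^ p * rho a y `^ beta)%:E)%E).
  apply: ge0_le_lower_integral => y /shellP[Sy yS].
    by rewrite mule_ge0// lee_fin ?powR_ge0// ltW.
  rewrite -EFinM lee_fin mulrC ler_wpM2l ?powR_ge0//.
  have [] := @powR_comparable V S (rho a y) beta V1 S0 _ _ => //.
    rewrite ler_pdivrMr// /V mulrCA mulrC -ler_pdivrMr//.
    by apply: le_trans Sy _; rewrite mulrC.
  apply: le_trans (rhoC _ _) _.
  apply: ler_pM => //; first exact: ltW; last exact: ltW.
  by rewrite /V ler_peMl// ltW.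
apply: ge0_lower_subset_integral; last exact: subDsetl.
by move=> y _; rewrite lee_fin mulr_ge0 ?powR_ge0.
Qed.

Let SpE (S : R) e : 0 < S -> S `^ (kappa + e) = S `^ kappa * S `^ e.
Proof. by move=> S0; rewrite powRD// (gt_eqF S0) implybT. Qed.

(** At the level [t = N * S ^ kappa] the p-norm term and the measure term of [integral_le_of_Lp] are
    both multiples of [t * S]. *)
Lemma shell_L1 : exists2 C : R, 0 < C &
  forall f N a S, measurable_fun setT f -> 0 < N -> morrey_bound f N -> 0 < S ->
    (\int[mu]_(y in shell a (S / 2) S) (`|f y|)%:E <=
      (C * N * S `^ (kappa + 1))%:E)%E.
Proof.
have two1 : 1 <= 2 :> R by rewrite ler1n.
have [C C_gt0 HC] := shell_Lp two1; exists (C + C0); first exact: addr_gt0.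
move=> f N a S mf N0 fN S0.
have t0 : 0 < N * S `^ kappa by rewrite mulr_gt0// powR_gt0.
have mS : measurable (shell a (S / 2) S) by exact: measurable_shell.
apply: le_trans (@integral_le_of_Lp p _ _ (N * S `^ kappa) _ (C0 * S) p1
  (fun x => normr_ge0 (f x)) (mabs mf) mS t0 (HC f N a S mf N0 fN S0) _) _.
  apply: le_trans (growth a S0); apply: le_measure; last exact: subDsetl.
  + exact/mem_set.
  + exact/mem_set.
rewrite SpE// powRr1 ?(ltW S0)// lee_fin le_eqVlt; apply/orP; left; apply/eqP.
set t := N * S `^ kappa in t0 *.
have -> : t `^ (1 - p) = t / t `^ p.
  by rewrite powRB ?powRr1 ?(ltW t0)// (gt_eqF t0) implybT.
transitivity ((C + C0) * t * S); last by rewrite /t; ring.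
by field; rewrite gt_eqF// powR_gt0.
Qed.

Let pow_half (S e : R) n : 0 < S -> (S / 2 ^+ n) `^ e = S `^ e * (2 ^+ n) `^ (- e).
Proof.
move=> S0; rewrite powRM ?invr_ge0 ?(ltW S0)// -[X in _ * X `^ _ = _]powR_inv1//.
by rewrite -powRrM mulN1r.
Qed.

Lemma ball_L1 : exists2 C : R, 0 < C &
  forall f N a S, measurable_fun setT f -> 0 < N -> morrey_bound f N -> 0 < S ->
    (\int[mu]_(y in qball rho a S) (`|f y|)%:E <=
      (C * N * S `^ (kappa + 1))%:E)%E.
Proof.
have [C C_gt0 HC] := shell_L1.
have D0 : 0 < (1 - 2 `^ (- (kappa + 1)))^-1 by rewrite invr_gt0 subr_gt0 powR2N_lt1.
exists (C * (1 - 2 `^ (- (kappa + 1)))^-1); first exact: mulr_gt0.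
move=> f N a S mf N0 fN S0.
apply: (@integral_qball_le a S _ _
  (fun n => C * N * S `^ (kappa + 1) * (2 ^+ n) `^ (- (kappa + 1)))) => // n.
- have r0 : 0 < S / 2 ^+ n by rewrite divr_gt0.
  have := HC f N a _ mf N0 fN r0.
  by rewrite pow_half// mulrA exprSr invfM mulrA.
- rewrite -mulr_sumr.
  have -> : C * (1 - 2 `^ (- (kappa + 1)))^-1 * N * S `^ (kappa + 1) =
     C * N * S `^ (kappa + 1) * (1 - 2 `^ (- (kappa + 1)))^-1 by ring.
  by apply: ler_wpM2l; [rewrite !mulr_ge0 ?powR_ge0// ltW|exact: sum_dyadic].
Qed.

(** * Contributions from far inside and far outside *)

Let potential_scale (f : X -> R) (A : set X) (c M : R) x :
  measurable_fun setT f -> measurable A -> 0 <= c ->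
  (forall y, A y -> rho x y `^ (alpha - 1) <= c) ->
  (\int[mu]_(y in A) `|f y|%:E <= M%:E)%E ->
  (\int[mu]_(y in A) (`|f y| * rho x y `^ (alpha - 1))%:E <= (c * M)%:E)%E.
Proof.
move=> mf mA c0 kc fM.
apply: (@le_trans _ _ (\int[mu]_(y in A) (c%:E * `|f y|%:E))%E).
  apply: ge0_le_lower_integral => y Ay; first by rewrite lee_fin mulr_ge0 ?powR_ge0.
  by rewrite -EFinM lee_fin mulrC ler_wpM2r// kc.
rewrite ge0_integralZl//; last first.
  by apply/measurable_EFinP; apply: measurable_funTS; exact: mabs.
by rewrite EFinM; apply: lee_wpmul2l.
Qed.

(** From [2 a1 S <= rho x a <= a1 (rho x y + rho y a)] and [rho y a < S] follows [S <= rho x y], so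
    the kernel is at most [S ^ (alpha - 1)] on the whole ball and [ball_L1] applies. *)
Lemma inner_potential : exists2 C : R, 0 < C &
  forall f N a S x, measurable_fun setT f -> 0 < N -> morrey_bound f N -> 0 < S ->
    2 * a1 * S <= rho x a ->
    (\int[mu]_(y in qball rho a S) (`|f y| * rho x y `^ (alpha - 1))%:E <=
      (C * N * S `^ (kappa + alpha))%:E)%E.
Proof.
have [C C_gt0 HC] := ball_L1; exists C => // f N a S x mf N0 fN S0 xa.
apply: le_trans (potential_scale mf (mball a S) (powR_ge0 S (alpha - 1)) _
  (HC f N a S mf N0 fN S0)) _.
  move=> y; rewrite /qball/= => ya.
  apply: ger_powR_base => //; first by rewrite subr_le0 ltW.
  have := le_trans xa (rhoD x a y); rewrite mulrAC mulrC ler_pM2l//.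
  by move=> ?; lra.
rewrite lee_fin !SpE// powRr1 ?(ltW S0)// le_eqVlt; apply/orP; left; apply/eqP.
rewrite -(mulr_powRB1 (ltW S0) al0); ring.
Qed.

(** Since [a1 * rho x a] is at most half of [rho y a], it follows that [rho y a <= 2 a0 a1 rho x y].
    The shell of radius [t] then contributes at most a multiple of [t ^ (kappa + alpha)], which
    decays along [t = S * 2 ^ n]. *)
Lemma outer_potential : exists2 C : R, 0 < C &
  forall f N a S x, measurable_fun setT f -> 0 < N -> morrey_bound f N -> 0 < S ->
    2 * a1 * rho x a <= S ->
    (\int[mu]_(y in ~` qball rho a S) (`|f y| * rho x y `^ (alpha - 1))%:E <=
      (C * N * S `^ (kappa + alpha))%:E)%E.
Proof.
have [C C_gt0 HC] := shell_L1.
pose e := - (kappa + alpha); have e0 : 0 < e by rewrite oppr_gt0.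
pose W := 2 * a0 * a1; have W0 : 0 < W by rewrite /W !mulr_gt0.
pose A := W `^ (1 - alpha) * C * 2 `^ (kappa + 1).
have A0 : 0 < A.
  by apply: mulr_gt0; [apply: mulr_gt0 => //|]; exact: powR_gt0.
have D0 : 0 < (1 - 2 `^ (- e))^-1 by rewrite invr_gt0 subr_gt0 powR2N_lt1.
exists (A * (1 - 2 `^ (- e))^-1); first exact: mulr_gt0.
move=> f N a S x mf N0 fN S0 xa.
apply: (@integral_setC_qball_le a S _ _
  (fun n => A * N * S `^ (kappa + alpha) * (2 ^+ n) `^ (- e))) => // n.
- by rewrite lee_fin mulr_ge0 ?powR_ge0.
- set t := S * 2 ^+ n; have t0 : 0 < t by rewrite mulr_gt0.
  have -> : S * 2 ^+ n.+1 = 2 * t by rewrite exprS /t mulrCA.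
  have t20 : 0 < 2 * t by rewrite mulr_gt0.
  have St : S <= t by rewrite /t ler_peMr ?(ltW S0)// exp2n_ge1.
  have := HC f N a _ mf N0 fN t20; rewrite [2 * t / 2]mulrAC divff// mul1r => HCt.
  have c0 : 0 <= W `^ (1 - alpha) * t `^ (alpha - 1) by rewrite mulr_ge0 ?powR_ge0.
  apply: le_trans (potential_scale mf (measurable_shell _ _ _) c0 _ HCt) _.
    move=> y /shellP[ty _]; apply: kernel_le => //.
    rewrite /W ler_pdivrMr; last by rewrite !mulr_gt0.
    have h1 := rhoD y a x; have h2 := rhoC y x.
    have h3 : a1 * rho y x <= a1 * (a0 * rho x y) by rewrite ler_wpM2l// ltW.
    have -> : rho x y * (2 * a0 * a1) = 2 * (a1 * (a0 * rho x y)) by ring.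
    move: h1 xa; rewrite mulrDr -mulrA; move: (a1 * rho x a) => u h1 xa.
    lra.
  rewrite lee_fin le_eqVlt; apply/orP; left; apply/eqP.
  have E1 : S `^ (kappa + alpha) * (2 ^+ n) `^ (- e) = t `^ (kappa + alpha).
    by rewrite /e opprK -powRM// ltW.
  have E2 : t `^ (kappa + alpha) = t `^ (kappa + 1) * t `^ (alpha - 1).
    by rewrite !SpE// powRr1 ?(ltW t0)// -(mulr_powRB1 (ltW t0) al0); ring.
  transitivity (A * N * (S `^ (kappa + alpha) * (2 ^+ n) `^ (- e))); last by ring.
  by rewrite E1 E2 [(2 * t) `^ _]powRM ?(ltW t0)// /A; ring.
- rewrite -mulr_sumr.
  have -> : A * (1 - 2 `^ (- e))^-1 * N * S `^ (kappa + alpha) =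
    A * N * S `^ (kappa + alpha) * (1 - 2 `^ (- e))^-1 by ring.
  by apply: ler_wpM2l; [rewrite !mulr_ge0 ?powR_ge0// ltW|exact: sum_dyadic].
Qed.

(** * Local L^q bounds for the potential *)

Definition potential (f : X -> R) (x : X) : \bar R :=
  (\int[mu]_y (`|f y| * rho x y `^ (alpha - 1))%:E)%E.

(* [H] comes from [maximal_majorant], applied to the part of [f] in a shell around
   [a] containing [x]; the other two parts of [f] are controlled at every point. *)
Lemma annulus_Lq : exists2 C : R, 0 < C &
  forall f N a r, measurable_fun setT f -> 0 < N -> morrey_bound f N -> 0 < r ->
    (\int[mu]_(x in shell a (r / 2) r)
      (potential f x `^ q * (rho a x `^ gamma)%:E) <=
      (C * N `^ q * r `^ lambda2)%:E)%E.
Proof.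
(* The ratio of the outer radius [2 a1 r] of the middle shell to its inner radius [r / (4 a1)]. *)
pose W := 8 * a1 ^+ 2; have W1 : 1 <= W.
  by rewrite /W -[leLHS]mulr1 ler_pM ?ler1n// exprn_ege1.
have [C1 C10 HC1] := shell_Lp W1.
have [Ci Ci0 HCi] := inner_potential.
have [Co Co0 HCo] := outer_potential.
have [Cn Cn0 HCn] := near_potential p1 pq al0 al1 apq C10.
have [Cm Cm0 HCm] := maximal_majorant p1.
pose e := kappa + alpha.
(* If [rho y a < 2 a1 r] and [rho x a < r], then [rho y x < b * r]: the middle shell lies in the
   ball of radius [L] around [x]. *)
pose b := a1 * (2 * a1 + a0); have b0 : 0 < b by rewrite /b mulr_gt0// addr_gt0// mulr_gt0.
pose B := Ci * ((4 * a1)^-1) `^ e + Co * (2 * a1) `^ e + Cn * (2 * a1) `^ kappa * b `^ alpha.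
have a1_2 : 0 < 2 * a1 by rewrite mulr_gt0.
have a1_4 : 0 < 4 * a1 by rewrite mulr_gt0.
have B0 : 0 < B.
  apply: addr_gt0; last by apply: mulr_gt0; [apply: mulr_gt0 => //|]; exact: powR_gt0.
  apply: addr_gt0; apply: mulr_gt0 => //; apply: powR_gt0 => //.
  by rewrite invr_gt0.
have a0_2 : 1 <= 2 * a0 by rewrite -[leLHS]mulr1 ler_pM ?ler1n.
pose V := (2 * a0) `^ `|gamma|; have V0 : 0 < V by apply: powR_gt0; rewrite mulr_gt0.
pose M := C0 + Cm * C1 * (2 * a1).
have M0 : 0 < M by apply: addr_gt0 => //; apply: mulr_gt0 => //; exact: mulr_gt0.
exists (B `^ q * V * M).
  by apply: mulr_gt0 => //; apply: mulr_gt0 => //; exact: powR_gt0.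
move=> f N a r mf N0 fN r0; have r0' := ltW r0.
(* For [x] in the shell, [2 a1 S1 = r / 2 <= rho x a] and [2 a1 rho x a <= S2], as the inner and
   outer bounds require. *)
pose S1 := r / (4 * a1); have S10 : 0 < S1 by exact: divr_gt0.
pose S2 := 2 * a1 * r; have S20 : 0 < S2 by exact: mulr_gt0.
pose L := b * r; have L0 : 0 < L by exact: mulr_gt0.
have S2L : S2 <= L.
  rewrite /S2 /L ler_wpM2r// /b mulrC ler_wpM2l ?(ltW a10)//.
  by have := a01; have := a11; lra.
have S2W : S2 / W = S1.
  by rewrite /S2 /W /S1; field; rewrite !gt_eqF.
pose G := N * S2 `^ kappa; have G0 : 0 < G by apply: mulr_gt0 => //; exact: powR_gt0.
pose A := shell a S1 S2; have mA : measurable A by exact: measurable_shell.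
pose g y := `|f y| * \1_A y.
have g0 y : 0 <= g y by rewrite mulr_ge0.
have mg : measurable_fun setT g.
  by apply: measurable_funM; [exact: mabs|exact: measurable_indic].
have gp : (\int[mu]_y (g y `^ p)%:E <= (C1 * G `^ p * S2)%:E)%E.
  have := HC1 f N a S2 mf N0 fN S20; rewrite S2W; apply: le_trans.
  rewrite [leRHS]integral_mkcond; apply: ge0_le_lower_integral => y _.
    by rewrite lee_fin powR_ge0.
  rewrite /g indicE /patch /A; case: ifP => _; first by rewrite mulr1.
  by rewrite mulr0 powR0// gt_eqF.
have [H [H0 mH Hv HE]] := HCm g G L g0 mg G0 L0 (le_lt_trans gp (ltry _)).
pose E := shell a (r / 2) r; have mE : measurable E by exact: measurable_shell.
have pointwise x : E x -> (H x < +oo)%E -> exists2 v : R,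
    ((v `^ p)%:E <= H x)%E & 1 <= v /\
    (potential f x <= (B * N * r `^ e * v `^ (p / q))%:E)%E.
  move=> /shellP[rx xr] /Hv[v v1 [vH Mg]]; exists v => //; split=> //.
  have k0 y : (0 <= (`|f y| * rho x y `^ (alpha - 1))%:E)%E.
    by rewrite lee_fin mulr_ge0 ?powR_ge0.
  have hi := HCi f N a S1 x mf N0 fN S10 _.
  have ho := HCo f N a S2 x mf N0 fN S20 _.
  have hn := HCn g G L x v g0 mg G0 L0 v1 _ Mg.
  have hA : (\int[mu]_(y in A) (`|f y| * rho x y `^ (alpha - 1))%:E <=
      (Cn * G * L `^ alpha * v `^ (p / q))%:E)%E.
    apply: le_trans (hn _); last first.
      apply: le_trans gp _; rewrite lee_fin ler_wpM2l// mulr_ge0 ?powR_ge0//.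
      exact: ltW.
    apply: (@le_trans _ _ (\int[mu]_(y in A) (g y * rho x y `^ (alpha - 1))%:E)%E).
      apply: ge0_le_lower_integral => // y Ay.
      by rewrite /g indicE mem_set// mulr1.
    apply: ge0_lower_subset_integral => [y _|y /shellP[_ yS]].
      by rewrite lee_fin mulr_ge0 ?powR_ge0.
    rewrite /qball/=; apply: le_lt_trans (rhoD y x a) _.
    rewrite /L /b -mulrA ltr_pM2l// mulrDl; apply: ltr_leD => //.
    by apply: le_trans (rhoC _ _) _; rewrite ler_pM2l// ltW.
  have cover : [set: X] `<=` (qball rho a S1 `|` A) `|` ~` qball rho a S2.
    move=> y _; have [yS|yS] := ltP (rho y a) S1; first by left; left.
    have [yS'|yS'] := ltP (rho y a) S2; first by left; right; apply/shellP.
    by right; rewrite /qball/=; apply/negP; rewrite -leNgt.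
  apply: le_trans (ge0_lower_subset_integral mu (fun y _ => k0 y) cover) _.
  have m1 := mball a S1; have m2 : measurable (~` qball rho a S2) by exact: measurableC.
  apply: le_trans (lower_integral_setU mu k0 (measurableU _ _ m1 mA) m2) _.
  apply: le_trans (leeD (lower_integral_setU mu k0 m1 mA) (le_refl _)) _.
  apply: le_trans (leeD (leeD (hi _) hA) (ho _)) _.
  - rewrite /S1; apply: le_trans rx.
    by rewrite le_eqVlt; apply/orP; left; apply/eqP; field; rewrite gt_eqF.
  - by rewrite /S2 ler_pM2l// ltW.
  rewrite -!EFinD lee_fin -/e.
  (* This allows the factor [v ^ (p / q)] to be inserted into the inner and outer bounds too. *)
  have w1 : 1 <= v `^ (p / q).
    have := @ler_powR_base R (p / q) 1 v _ ler01 v1.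
    by rewrite powR1; apply; rewrite ltW// divr_gt0.
  have E1 : S1 `^ e = ((4 * a1)^-1) `^ e * r `^ e.
    by rewrite /S1 mulrC powRM// invr_ge0 ltW.
  have E2 : S2 `^ e = (2 * a1) `^ e * r `^ e by rewrite /S2 powRM// ltW.
  have E3 : G * L `^ alpha = N * (2 * a1) `^ kappa * b `^ alpha * r `^ e.
    rewrite /G /S2 /L [r `^ e]SpE// (powRM _ (ltW a1_2) r0') (powRM _ (ltW b0) r0').
    by ring.
  rewrite E1 E2 -[Cn * G * _]mulrA E3 -subr_ge0.
  set w := v `^ _ in w1 *.
  have -> : B * N * r `^ e * w -
      (Ci * N * ((4 * a1)^-1 `^ e * r `^ e) +
       Cn * (N * (2 * a1) `^ kappa * b `^ alpha * r `^ e) * w +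
       Co * N * ((2 * a1) `^ e * r `^ e)) =
      (Ci * (4 * a1)^-1 `^ e + Co * (2 * a1) `^ e) * N * r `^ e * (w - 1).
    by rewrite /B; ring.
  apply: mulr_ge0; last by rewrite subr_ge0.
  apply: mulr_ge0; last exact: powR_ge0.
  apply: mulr_ge0; last exact: ltW.
  by apply: addr_ge0; apply: mulr_ge0; rewrite ?powR_ge0// ltW.
pose D := (B * N * r `^ e) `^ q * (V * r `^ gamma).
have D0 : 0 < D.
  apply: mulr_gt0; last by apply: mulr_gt0 => //; exact: powR_gt0.
  apply: powR_gt0; apply: mulr_gt0; [exact: mulr_gt0|exact: powR_gt0].
apply: (@le_trans _ _ (\int[mu]_(x in E) (D%:E * H x))%E).
  apply: ge0_le_lower_integral => x Ex.
    by rewrite mule_ge0 ?poweR_ge0// lee_fin powR_ge0.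
  (* Where [H] is infinite so is the right-hand side, since [D > 0]. *)
  have [Hfin|] := ltP (H x) +oo%E; last first.
    by rewrite leye_eq => /eqP ->; rewrite gt0_muley ?lte_fin// leey.
  have [v vH [v1 Iv]] := pointwise x Ex Hfin.
  have I0 : (0 <= potential f x)%E.
    by apply: integral_ge0 => y _; rewrite lee_fin mulr_ge0 ?powR_ge0.
  (* The q-th power turns [v ^ (p / q)] into [v ^ p], which [H] dominates. *)
  have Iq : (potential f x `^ q <= ((B * N * r `^ e) `^ q)%:E * H x)%E.
    apply: (@le_trans _ _ ((B * N * r `^ e * v `^ (p / q))%:E `^ q)%E).
      have nn : 0 <= B * N * r `^ e * v `^ (p / q).
        by rewrite !mulr_ge0 ?powR_ge0 ?(ltW B0) ?(ltW N0).
      apply: gt0_ler_poweR => //; first exact: ltW.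
      + by rewrite in_itv/= I0 leey.
      + by rewrite in_itv/= lee_fin nn leey.
    rewrite poweR_EFin powRM ?mulr_ge0 ?powR_ge0 ?(ltW B0) ?(ltW N0)//.
    rewrite -powRrM mulfVK ?gt_eqF// EFinM.
    by apply: lee_wpmul2l => //; rewrite lee_fin powR_ge0.
  have xg : rho a x `^ gamma <= V * r `^ gamma.
    have /shellP[rx xr] := Ex.
    have [] := @powR_comparable (2 * a0) r (rho a x) gamma a0_2 r0 _ _ => //.
    + rewrite ler_pdivrMr; last by rewrite mulr_gt0.
      have := rhoC x a => xa; rewrite mulrCA mulrC -ler_pdivrMr//.
      by apply: le_trans rx _; rewrite mulrC.
    + apply: le_trans (rhoC _ _) _; rewrite -mulrA mulrCA ler_wpM2l ?(ltW a00)//.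
      by move: xr r0; lra.
  have -> : (D%:E * H x = ((B * N * r `^ e) `^ q)%:E * H x * (V * r `^ gamma)%:E)%E.
    by rewrite /D EFinM muleAC.
  by apply: lee_pmul => //; rewrite ?poweR_ge0 ?lee_fin ?powR_ge0.
have D0' : (0 <= D%:E)%E by rewrite lee_fin ltW.
rewrite ge0_integralZl//; last exact: measurable_funTS.
have muE : (mu E <= (C0 * r)%:E)%E.
  apply: le_trans (growth a r0); apply: le_measure; last exact: subDsetl.
  + exact/mem_set.
  + exact/mem_set.
apply: (@le_trans _ _ (D%:E * (M * r)%:E)%E).
  apply: lee_wpmul2l; first by rewrite lee_fin ltW.
  apply: le_trans (HE E mE) _.
  apply: (@le_trans _ _ ((C0 * r)%:E + (Cm * G `^ (- p))%:E * (C1 * G `^ p * S2)%:E)%E).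
    apply: leeD => //; apply: lee_wpmul2l => //.
    by rewrite lee_fin mulr_ge0 ?powR_ge0// ltW.
  (* The powers of [G] cancel, leaving a constant times [r]. *)
  rewrite -EFinM -EFinD lee_fin powRN le_eqVlt; apply/orP; left; apply/eqP.
  by rewrite /M /S2; field; rewrite gt_eqF// powR_gt0.
rewrite -EFinM lee_fin le_eqVlt; apply/orP; left; apply/eqP.
(* The powers of [r] are [e * q] from the potential, [gamma] from the weight and 1 from the measure;
   the choice of [gamma] makes them add up to [lambda1 * q / p]. *)
have -> : lambda2 = e * q + gamma + 1.
  apply: (mulIf (lt0r_neq0 p0)); rewrite -l12 gammaE /e /kappa.
  by field; rewrite gt_eqF.
rewrite powRD; last by rewrite (gt_eqF r0) implybT.
rewrite powRD; last by rewrite (gt_eqF r0) implybT.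
rewrite powRr1// /D !powRM ?mulr_ge0 ?powR_ge0 ?(ltW B0) ?(ltW N0)// -powRrM.
by ring.
Qed.

(** The annulus bounds at radii [r / 2 ^ n] carry the factors [2 ^ (- n lambda2)], summable because
    [lambda2] inherits its sign from [lambda1]. *)
Lemma potential_Lq : exists2 C : R, 0 < C &
  forall f N a r, measurable_fun setT f -> 0 < N -> morrey_bound f N -> 0 < r ->
    (\int[mu]_(x in qball rho a r)
      (potential f x `^ q * (rho a x `^ gamma)%:E) <=
      (C * N `^ q * r `^ lambda2)%:E)%E.
Proof.
have [C C_gt0 HC] := annulus_Lq.
have l20 : 0 < lambda2.
  have : 0 < lambda2 * p by rewrite -l12 mulr_gt0.
  by rewrite pmulr_lgt0.
have D0 : 0 < (1 - 2 `^ (- lambda2))^-1 by rewrite invr_gt0 subr_gt0 powR2N_lt1.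
exists (C * (1 - 2 `^ (- lambda2))^-1); first exact: mulr_gt0.
move=> f N a r mf N0 fN r0.
apply: (@integral_qball_le a r _ _
  (fun n => C * N `^ q * r `^ lambda2 * (2 ^+ n) `^ (- lambda2))) => // n.
- by rewrite mule_ge0 ?poweR_ge0// lee_fin powR_ge0.
- have rn0 : 0 < r / 2 ^+ n by rewrite divr_gt0.
  have := HC f N a _ mf N0 fN rn0.
  by rewrite pow_half// mulrA exprSr invfM mulrA.
- rewrite -mulr_sumr.
  have -> : C * (1 - 2 `^ (- lambda2))^-1 * N `^ q * r `^ lambda2 =
     C * N `^ q * r `^ lambda2 * (1 - 2 `^ (- lambda2))^-1 by ring.
  by apply: ler_wpM2l; [rewrite !mulr_ge0 ?powR_ge0// ltW|exact: sum_dyadic].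
Qed.

End morrey.
End growth_space.

(** * From integral bounds to Morrey norms *)

Lemma lee_of_gt (R : realType) (x : \bar R) (C n : R) : 0 < C ->
  (forall m : R, n < m -> (x <= (C * m)%:E)%E) -> (x <= (C * n)%:E)%E.
Proof.
move=> C0 H; apply/lee_addgt0Pr => eps eps0.
have -> : ((C * n)%:E + eps%:E = (C * (n + eps / C))%:E)%E.
  by rewrite -EFinD; congr _%:E; field; rewrite gt_eqF.
by apply: H; rewrite ltrDl divr_gt0.
Qed.

Lemma poweR_le_root (R : realType) (x : \bar R) (M p : R) : 0 < p -> 0 <= M ->
  (0 <= x)%E -> (x `^ p^-1 <= M%:E)%E = (x <= (M `^ p)%:E)%E.
Proof.
move=> p0 M0 x0; have pV0 : 0 < p^-1 by rewrite invr_gt0.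
have xp : ((x `^ p^-1) `^ p = x)%E by rewrite -poweRrM mulVf ?gt_eqF// poweRe1.
have Mp : ((M `^ p)%:E `^ p^-1 = M%:E)%E.
  by rewrite poweR_EFin -powRrM mulfV ?gt_eqF// powRr1.
apply/idP/idP => h.
- rewrite -xp -poweR_EFin; apply: gt0_ler_poweR => //; first exact: ltW.
  + by rewrite in_itv/= poweR_ge0 leey.
  + by rewrite in_itv/= lee_fin M0 leey.
- rewrite -Mp; apply: gt0_ler_poweR => //; first exact: ltW.
  + by rewrite in_itv/= x0 leey.
  + by rewrite in_itv/= lee_fin powR_ge0 leey.
Qed.

Theorem theorem3p3 (R : realType) (d : measure_display) (X : measurableType d)
  (op : set (set X)) (rho : X -> X -> R) (mu : {measure set X -> \bar R})
  (p q alpha beta lambda1 lambda2 : R) :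
  quasimetric_measure_space op rho mu ->
  (exists2 C0 : R, 0 < C0 &
     forall (a : X) (r : R), 0 < r -> (mu (qball rho a r) <= (C0 * r)%:E)%E) ->
  1 < p -> p <= q ->
  0 < alpha -> p^-1 - q^-1 <= alpha -> alpha < 1 -> alpha != p^-1 ->
  p * alpha - 1 < beta -> beta < p - 1 ->
  0 < lambda1 -> lambda1 < beta - alpha * p + 1 ->
  lambda1 * q = lambda2 * p ->
  let gamma := q * (p^-1 + beta / p - alpha) - 1 in
  exists2 C : R, 0 < C &
    forall f : X -> R, measurable_fun setT f ->
      (morrey_norm rho mu p lambda1 beta (EFin \o f) < +oo)%E ->
      (morrey_norm rho mu q lambda2 gamma (frac_int rho mu alpha f)
         <= C%:E * morrey_norm rho mu p lambda1 beta (EFin \o f))%E.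
Proof.
move=> [_ _ _ [rho0 rho_gt0 rhoxx [a0 [a1 [a01 a11 rhoC rhoD]]]]
  [mball _ _ [_ mu1 _]]] [C0 C00 growth] p1 pq al0 apq al1 _ _ betap l10 l1b l12 gamma.
have p0 : 0 < p by apply: lt_trans p1.
have q0 : 0 < q by apply: lt_le_trans pq.
have [C C_gt0 HC] := potential_Lq a01 a11 C00 rho0 rho_gt0 rhoxx rhoC rhoD mball growth
  mu1 p1 pq al0 al1 apq betap l10 l1b l12 (erefl gamma).
pose C' := C `^ q^-1; have C'0 : 0 < C' by exact: powR_gt0.
exists C' => // f mf; set n := morrey_norm _ _ _ _ _ _ => nfin.
have n_ge a r : 0 < r -> (((r `^ (- lambda1))%:E *
    \int[mu]_(y in qball rho a r) (`|f y| `^ p * rho a y `^ beta)%:E) `^ p^-1 <= n)%E.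
  by move=> r0; apply: ereal_sup_ubound; exists a, r.
have n0 : (0 <= n)%E by apply: le_trans (n_ge point 1 ltr01); exact: poweR_ge0.
have nE : n = (fine n)%:E by rewrite fineK// ge0_fin_numE.
(* The norm may vanish whereas the integral bounds take a positive [N], so [N] runs over the reals
   above the norm. *)
rewrite nE -EFinM; apply: lee_of_gt => // N nN.
have N0 : 0 < N by apply: le_lt_trans nN; rewrite -lee_fin -nE.
have fN : morrey_bound mu rho p beta lambda1 f N.
  move=> a r r0.
  have I0 : (0 <= \int[mu]_(y in qball rho a r) (`|f y| `^ p * rho a y `^ beta)%:E)%E.
    by apply: integral_ge0 => y _; rewrite lee_fin mulr_ge0 ?powR_ge0.
  have r1 : 0 < r `^ (- lambda1) by exact: powR_gt0.
  have := le_trans (n_ge a r r0) (_ : n <= N%:E)%E.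
  rewrite poweR_le_root ?(ltW N0)//; last by rewrite mule_ge0// lee_fin ltW.
  have nN' : (n <= N%:E)%E by rewrite nE lee_fin ltW.
  by move=> /(_ nN') /(lee_scale r1); rewrite -powRN opprK mulrC.
apply: ge_ereal_sup => _ [a [r [r0 ->]]].
have I0 : (0 <= \int[mu]_(x in qball rho a r)
    (`|frac_int rho mu alpha f x| `^ q * (rho a x `^ gamma)%:E))%E.
  by apply: integral_ge0 => x _; rewrite mule_ge0 ?poweR_ge0// lee_fin powR_ge0.
rewrite poweR_le_root ?mulr_ge0 ?(ltW C'0) ?(ltW N0)//; last first.
  by rewrite mule_ge0// lee_fin powR_ge0.
have IC : (\int[mu]_(x in qball rho a r)
    (`|frac_int rho mu alpha f x| `^ q * (rho a x `^ gamma)%:E) <=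
    (C * N `^ q * r `^ lambda2)%:E)%E.
  apply: le_trans (HC f N a r mf N0 fN r0); apply: ge0_le_lower_integral => x _.
    by rewrite mule_ge0 ?poweR_ge0// lee_fin powR_ge0.
  apply: lee_wpmul2r; first by rewrite lee_fin powR_ge0.
  (* The sign of [f] is removed here by the modulus estimate valid for nonmeasurable integrands. *)
  have le_pot : (`|frac_int rho mu alpha f x| <= potential mu rho alpha f x)%E.
    apply: le_trans (le_abse_lower_integral _ _ _) _.
    apply: ge0_le_lower_integral => y _ //.
    by rewrite abse_EFin normrM (ger0_norm (powR_ge0 _ _)).
  apply: gt0_ler_poweR => //; first exact: ltW.
  - by rewrite in_itv/= abse_ge0 leey.
  - by rewrite in_itv/= (le_trans _ le_pot)//= leey.
apply: (@le_trans _ _ ((r `^ (- lambda2))%:E * (C * N `^ q * r `^ lambda2)%:E)%E).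
  by apply: lee_wpmul2l => //; rewrite lee_fin powR_ge0.
rewrite -EFinM lee_fin powRM ?(ltW C'0) ?(ltW N0)// /C' -powRrM mulVf ?gt_eqF//.
rewrite powRr1 ?(ltW C_gt0)// powRN le_eqVlt; apply/orP; left; apply/eqP.
by field; rewrite gt_eqF// powR_gt0.
Qed.
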